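(* Let $\mathfrak{g}=(\mathfrak{g},\partial_{\mathfrak{g}},[\cdot,\cdot]_{\mathfrak{g}})$ be a dg Lie algebra over a field of characteristic zero, and let $H=H(\mathfrak{g},\partial_{\mathfrak{g}})$ be the graded cohomology space of the cochain complex $(\mathfrak{g},\partial_{\mathfrak{g}})$. For each $\ell$, choose a basis $\mathbf{b}^\ell=(\overline{\vartheta^\ell_k})_k$ of $H^\ell(\mathfrak{g},\partial_{\mathfrak{g}})$ and representative cocycles $\vartheta_k^\ell\in\mathfrak{g}^\ell$ of its elements, and let $f_1:H\to\mathfrak{g}$ be the degree $0$ linear map with $f_1\big(\sum_k\lambda_k^\ell\overline{\vartheta_k^\ell}\big)=\sum_k\lambda_k^\ell\vartheta_k^\ell$. Let $\ell_1=0:H\to H$ (so that the equations $(\mathcal{E}_1)$ and $(\mathfrak{J}_1)$ hold). With the equations $(\mathcal{E}_n)$ and $(\mathfrak{J}_n)$ as written out in the context: (a) There exist skew-symmetric graded linear maps $\ell_2:H\otimes H\to H$ and $f_2:H\otimes H\to\mathfrak{g}$, of degrees $\deg(\ell_2)=0$ and $\deg(f_2)=-1$, such that $(\mathcal{E}_2)$ and $(\mathfrak{J}_2)$ are satisfied. Moreover, such a map $\ell_2$ also satisfies $(\mathfrak{J}_3)$. (b) Let $m\ge3$ be an integer. For any skew-symmetric graded linear maps $\ell_k:\bigotimes^kH\to H$ and $f_k:\bigotimes^kH\to\mathfrak{g}$, $2\le k\le m-1$, of degrees $\deg(\ell_k)=2-k$ and $\deg(f_k)=1-k$, such that $(\mathfrak{J}_2),\dots,(\mathfrak{J}_m)$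 and $(\mathcal{E}_2),\dots,(\mathcal{E}_{m-1})$ are satisfied, there exist skew-symmetric graded linear maps $\ell_m:\bigotimes^mH\to H$ and $f_m:\bigotimes^mH\to\mathfrak{g}$ with $\deg(f_m)=1-m$, $\deg(\ell_m)=2-m$, satisfying $(\mathcal{E}_m)$. Moreover, such a map $\ell_m$ necessarily also satisfies $(\mathfrak{J}_{m+1})$.
   Context: Graded means $\mathbf{Z}$-graded; $|\xi|$ is the degree of a homogeneous element. A dg Lie algebra is a graded Lie algebra with a degree $1$ differential $\partial_{\mathfrak{g}}$ ($\partial_{\mathfrak{g}}^2=0$) that is a graded derivation of the bracket. $\overline{x}$ is the cohomology class of a cocycle $x$. For homogeneous $\xi_1,\dots,\xi_n$ and a permutation $\sigma\in\mathfrak{S}_n$, $\chi(\sigma)=\chi(\sigma;\xi_1,\dots,\xi_n)=\mathrm{sign}(\sigma)\varepsilon(\sigma)$, where $\varepsilon(\sigma)$ is the Koszul sign defined by $\xi_1\wedge\dots\wedge\xi_n=\varepsilon(\sigma)\,\xi_{\sigma(1)}\wedge\dots\wedge\xi_{\sigma(n)}$ in the free graded commutative algebra ($x\wedge y=(-1)^{|x||y|}y\wedge x$). A linear map $g$ on $\bigotimes^nH$ is skew-symmetric if $g(\xi_{\sigma(1)},\dots,\xi_{\sigma(n)})=\chi(\sigma)g(\xi_1,\dots,\xi_n)$ for all homogeneous $\xi_i$ and all $\sigma$. $S_{i,j}$ is the set of $(i,j)$-shuffles: $\sigma\in\mathfrak{S}_{i+j}$ with $\sigma(1)<\dots<\sigma(i)$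 and $\sigma(i+1)<\dots<\sigma(i+j)$. Since $\ell_1=0$, the equation $(\mathfrak{J}_n)$ (involving only $\ell_2,\dots,\ell_{n-1}$) is: for all homogeneous $\xi_1,\dots,\xi_n\in H$, $$\sum_{\substack{i+j=n+1\\ i,j\ge2}}\ \sum_{\sigma\in S_{i,n-i}}\chi(\sigma)(-1)^{i(j-1)}\ell_j\big(\ell_i(\xi_{\sigma(1)},\dots,\xi_{\sigma(i)}),\xi_{\sigma(i+1)},\dots,\xi_{\sigma(n)}\big)=0$$ (empty for $n=1,2$), and the equation $(\mathcal{E}_n)$ is: for all homogeneous $\xi_1,\dots,\xi_n\in H$, $$\partial_{\mathfrak{g}}(f_n(\xi_1,\dots,\xi_n))-f_1(\ell_n(\xi_1,\dots,\xi_n))=T_n(\xi_1,\dots,\xi_n),$$ where $$T_n(\xi_1,\dots,\xi_n)=\sum_{\substack{j+k=n+1\\ j,k\ge2}}\ \sum_{\sigma\in S_{k,n-k}}\chi(\sigma)(-1)^{k(j-1)}f_j\big(\ell_k(\xi_{\sigma(1)},\dots,\xi_{\sigma(k)}),\xi_{\sigma(k+1)},\dots,\xi_{\sigma(n)}\big)$$ $$-\sum_{\substack{s+t=n\\ s,t\ge1}}\ \sum_{\substack{\tau\in S_{s,n-s}\\ \tau(1)=1}}\chi(\tau)e_{s,t}(\tau)\big[f_s(\xi_{\tau(1)},\dots,\xi_{\tau(s)}),f_t(\xi_{\tau(s+1)},\dots,\xi_{\tau(n)})\big]_{\mathfrak{g}},$$ with $e_{s,t}(\tau)=(-1)^{s-1}(-1)^{(t-1)\sum_{p=1}^s|\xi_{\tau(p)}|}$.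 *)

(* Defs.v *)
From HB Require Import structures.
From mathcomp Require Import all_boot all_order all_fingroup all_algebra generic_quotient.
From mathcomp Require Import boolp.

Set Implicit Arguments.
Unset Strict Implicit.
Unset Printing Implicit Defensive.

Import GRing.Theory.
Local Open Scope ring_scope.
Local Open Scope quotient_scope.

(* Gradings are internal: V is the direct sum of the subspaces homog i, and   *)
(* x \in homog i reads "x is homogeneous of degree i" (0 is homogeneous of    *)
(* every degree).                                                             *)
HB.mixin Record isGraded (K : fieldType) V of GRing.Lmodule K V := {
  homog : int -> {pred V};
  homog_submod : forall i, submod_closed (homog i);
  homog_span : forall v : V, exists (s : seq int) (c : int -> V),
    [/\ uniq s, forall i, c i \in homog i & v = \sum_(i <- s) c i];
  homog_free : forall (s : seq int) (c : int -> V),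
    uniq s -> (forall i, c i \in homog i) -> \sum_(i <- s) c i = 0 ->
    {in s, forall i, c i = 0}
}.

#[short(type="gradedLmodType")]
HB.structure Definition GradedLmodule (K : fieldType) :=
  {V of GRing.Lmodule K V & isGraded K V}.

HB.mixin Record isCochainComplex (K : fieldType) V of GradedLmodule K V := {
  diff : V -> V;
  diff_linear : linear diff;
  diff_degree : forall (i : int) (x : V), x \in homog i -> diff x \in homog (i + 1);
  diff_diff : forall x : V, diff (diff x) = 0
}.

#[short(type="complexType")]
HB.structure Definition CochainComplex (K : fieldType) :=
  {V of GradedLmodule K V & isCochainComplex K V}.

HB.mixin Record isDGLie (K : fieldType) V of CochainComplex K V := {
  bracket : V -> V -> V;
  bracket_linearl : forall y : V, linear (bracket^~ y);
  bracket_linearr : forall x : V, linear (bracket x);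
  bracket_degree : forall (i j : int) (x y : V),
    x \in homog i -> y \in homog j -> bracket x y \in homog (i + j);
  bracket_skew : forall (i j : int) (x y : V),
    x \in homog i -> y \in homog j ->
    bracket x y = - ((-1) ^ (i * j) *: bracket y x);
  bracket_jacobi : forall (i j k : int) (x y z : V),
    x \in homog i -> y \in homog j -> z \in homog k ->
    bracket x (bracket y z) =
      bracket (bracket x y) z + (-1) ^ (i * j) *: bracket y (bracket x z);
  diff_bracket : forall (i j : int) (x y : V),
    x \in homog i -> y \in homog j ->
    diff (bracket x y) = bracket (diff x) y + (-1) ^ i *: bracket x (diff y)
}.

#[short(type="dgLieType")]
HB.structure Definition DGLie (K : fieldType) :=
  {V of CochainComplex K V & isDGLie K V}.

Section Graded.
Variables (K : fieldType) (V : gradedLmodType K).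

HB.instance Definition _ (i : int) :=
  GRing.isSubmodClosed.Build K V (homog i) (homog_submod i).

End Graded.

Section Cohomology.
Variables (K : fieldType) (C : complexType K).

HB.instance Definition _ :=
  GRing.isLinear.Build K C C *:%R (@diff K C) (@diff_linear K C).

Definition is_cocycle : {pred C} := [pred x | diff x == 0].

Fact is_cocycle_submod : submod_closed is_cocycle.
Proof.
split=> [|a x y]; rewrite !inE ?linear0 // => /eqP dx /eqP dy.
by rewrite linearP /= dx dy scaler0 addr0.
Qed.

HB.instance Definition _ :=
  GRing.isSubmodClosed.Build K C is_cocycle is_cocycle_submod.

Record cocycle := Cocycle { cocycle_val : C; _ : cocycle_val \in is_cocycle }.

HB.instance Definition _ := [isSub for cocycle_val].
HB.instance Definition _ := [Choice of cocycle by <:].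
HB.instance Definition _ := [SubChoice_isSubLmodule of cocycle by <:].

Definition is_coboundary : {pred cocycle} :=
  [pred z | `[< exists y : C, diff y = \val z >]].

Fact is_coboundary_submod : submod_closed is_coboundary.
Proof.
split=> [|a x y]; rewrite !inE.
  by apply/asboolP; exists 0; rewrite linear0.
move=> /asboolP[u du] /asboolP[v dv]; apply/asboolP.
by exists (a *: u + v); rewrite !linearP /= du dv.
Qed.

HB.instance Definition _ :=
  GRing.isSubmodClosed.Build K cocycle is_coboundary is_coboundary_submod.

Definition cohomology : Type := (Quotient.quot is_coboundary).

HB.instance Definition _ := Choice.on cohomology.
HB.instance Definition _ := GRing.Zmodule.on cohomology.

Definition cohom_class (z : cocycle) : cohomology := \pi_(Quotient.quot is_coboundary) z.

Lemma cohom_class_eq (x y : cocycle) :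
  cohom_class x = cohom_class y <-> exists u : C, diff u = \val x - \val y.
Proof.
have -> : (cohom_class x = cohom_class y) <-> (x - y \in is_coboundary).
  by rewrite Quotient.idealrBE; split=> [/eqP|/eqP].
rewrite inE -(linearB (\val : cocycle -> C)).
by split=> [/asboolP|/asboolP].
Qed.

Lemma cohom_class_surj (h : cohomology) : exists z, cohom_class z = h.
Proof. by exists (repr h); rewrite /cohom_class reprK. Qed.

Fact cohom_class_is_zmod_morphism : zmod_morphism cohom_class.
Proof. by move=> x y; rewrite /cohom_class raddfB. Qed.

Definition cohom_scale (a : K) (h : cohomology) : cohomology :=
  cohom_class (a *: repr h).

Fact cohom_scaleE a z : cohom_scale a (cohom_class z) = cohom_class (a *: z).
Proof.
rewrite /cohom_scale; apply/cohom_class_eq.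
have /cohom_class_eq[u du] : cohom_class (repr (cohom_class z)) = cohom_class z.
  by rewrite /cohom_class reprK.
by exists (a *: u); rewrite !linearZ /= du scalerDr.
Qed.

Fact cohom_scaleA a b h : cohom_scale a (cohom_scale b h) = cohom_scale (a * b) h.
Proof.
by have [z <-] := cohom_class_surj h; rewrite !cohom_scaleE scalerA.
Qed.

Fact cohom_scale1 : left_id 1 cohom_scale.
Proof.
by move=> h; have [z <-] := cohom_class_surj h; rewrite cohom_scaleE scale1r.
Qed.

Fact cohom_scaleDr : right_distributive cohom_scale +%R.
Proof.
move=> a h k; have [x <-] := cohom_class_surj h; have [y <-] := cohom_class_surj k.
have addE u v : cohom_class u + cohom_class v = cohom_class (u + v).
  by rewrite /cohom_class raddfD.
by rewrite addE !cohom_scaleE addE scalerDr.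
Qed.

Fact cohom_scaleDl h : {morph cohom_scale^~ h : a b / a + b}.
Proof.
move=> a b; have [x <-] := cohom_class_surj h.
have addE u v : cohom_class u + cohom_class v = cohom_class (u + v).
  by rewrite /cohom_class raddfD.
by rewrite /= !cohom_scaleE addE scalerDl.
Qed.

HB.instance Definition _ := GRing.Zmodule_isLmodule.Build K cohomology
  cohom_scaleA cohom_scale1 cohom_scaleDr cohom_scaleDl.

Fact cohom_class_linear : linear cohom_class.
Proof.
move=> a x y; rewrite [a *: cohom_class x]cohom_scaleE.
by rewrite {1}/cohom_class raddfD.
Qed.

HB.instance Definition _ :=
  GRing.isLinear.Build K cocycle cohomology *:%R cohom_class cohom_class_linear.

Definition cohom_homog (i : int) : {pred cohomology} :=
  [pred h | `[< exists2 z, \val z \in homog i & cohom_class z = h >]].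

Fact cohom_homog_submod i : submod_closed (cohom_homog i).
Proof.
split=> [|a h k]; rewrite !inE.
  by apply/asboolP; exists 0; rewrite ?linear0 ?rpred0.
move=> /asboolP[x xi <-] /asboolP[y yi <-]; apply/asboolP.
by exists (a *: x + y); rewrite !linearP //= rpredD ?rpredZ.
Qed.


Let sum_extend (A : zmodType) (s r : seq int) (F : int -> A) :
    uniq s -> uniq r -> {subset s <= r} ->
  \sum_(i <- r) (if i \in s then F i else 0) = \sum_(i <- s) F i.
Proof.
move=> us ur sr; rewrite -big_mkcond -big_filter; apply: perm_big.
apply: uniq_perm; rewrite ?filter_uniq // => i.
by rewrite mem_filter andb_idr //; apply: sr.
Qed.

Fact homog_diff (s : seq int) (c : int -> C) : uniq s ->
    (forall i, c i \in homog i) -> \sum_(i <- s) diff (c i) = 0 ->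
  {in s, forall i, diff (c i) = 0}.
Proof.
move=> us hc dc i si.
have free0 := @homog_free K C (map (+%R^~ 1) s) (fun j => diff (c (j - 1))).
rewrite -[i in LHS](addrK 1); apply: free0 (map_f _ si).
- by rewrite map_inj_uniq //; apply: addIr.
- by move=> j; have /diff_degree := hc (j - 1); rewrite subrK.
- by rewrite big_map -[RHS]dc; apply: eq_bigr => j _; rewrite addrK.
Qed.

Fact cohom_homog_span (h : cohomology) : exists (s : seq int) (c : int -> cohomology),
  [/\ uniq s, forall i, c i \in cohom_homog i & h = \sum_(i <- s) c i].
Proof.
have [z <-] := cohom_class_surj h.
have [s [c [us hc zE]]] := homog_span (\val z).
have dc : {in s, forall i, diff (c i) = 0}.
  apply: homog_diff => //; rewrite -linear_sum -zE; exact/eqP/(valP z).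
pose c' i := if i \in s then c i else 0.
have c'P i : c' i \in is_cocycle.
  rewrite inE /c'; case: ifPn => [/dc->//|_].
  by rewrite linear0.
exists s, (fun i => cohom_class (Cocycle (c'P i))); split=> //.
  move=> i; rewrite inE; apply/asboolP; exists (Cocycle (c'P i)) => //=.
  by rewrite /c'; case: ifP => // _; apply: rpred0.
rewrite -linear_sum; congr cohom_class; apply: val_inj.
rewrite zE linear_sum /=; apply: eq_big_seq => i si.
by rewrite /c' si.
Qed.

Fact cohom_homog_free (s : seq int) (c : int -> cohomology) :
    uniq s -> (forall i, c i \in cohom_homog i) -> \sum_(i <- s) c i = 0 ->
  {in s, forall i, c i = 0}.
Proof.
move=> us hc c0.
have /choice[z zP] : forall i, exists z, \val z \in homog i /\ cohom_class z = c i.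
  by move=> i; have := hc i; rewrite inE => /asboolP[z zi zc]; exists z.
have [u du] : exists u : C, diff u = \sum_(i <- s) \val (z i).
  have /cohom_class_eq[u du] : cohom_class (\sum_(i <- s) z i) = cohom_class 0.
    rewrite linear0 -c0 linear_sum; apply: eq_bigr => i _.
    by have [] := zP i.
  by exists u; rewrite du (linear0 (\val : cocycle -> C)) subr0 linear_sum.
have [t [e [ut he uE]]] := homog_span u.
pose t' := map (+%R^~ 1) t.
have ut' : uniq t' by rewrite map_inj_uniq //; apply: addIr.
pose r := undup (s ++ t').
pose b i := if i \in t' then e (i - 1) else 0.
have hb i : diff (b i) \in homog i.
  rewrite /b; case: ifP => _; last by rewrite linear0 rpred0.
  by have /diff_degree := he (i - 1); rewrite subrK.
have key : {in r, forall i, (if i \in s then \val (z i) else 0) - diff (b i) = 0}.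
  apply: (@homog_free K C); rewrite ?undup_uniq //.
    move=> i; apply: rpredB => //; case: ifP => _; last exact: rpred0.
    by have [] := zP i.
  rewrite big_split /= sumrN !sum_extend ?undup_uniq //; last first.
    by move=> i si; rewrite mem_undup mem_cat si.
  suff -> : \sum_(i <- r) diff (b i) = diff u by rewrite -du subrr.
  rewrite -linear_sum; congr diff; rewrite /b sum_extend ?undup_uniq //.
    by rewrite big_map uE; apply: eq_bigr => i _; rewrite addrK.
  by move=> i si; rewrite mem_undup mem_cat si orbT.
move=> i si; have [_ <-] := zP i.
rewrite -[RHS](linear0 cohom_class); apply/cohom_class_eq; exists (b i).
have := key i; rewrite mem_undup mem_cat si => /(_ isT)/eqP.
by rewrite subr_eq0 => /eqP <-; rewrite (linear0 (\val : cocycle -> C)) subr0.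
Qed.

HB.instance Definition _ := isGraded.Build K cohomology
  cohom_homog_submod cohom_homog_span cohom_homog_free.

End Cohomology.

Section Signs.
Variables (K : fieldType) (n : nat) (d : 'I_n -> int).
Implicit Type s : 'S_n.

(* The sign of x_1 /\ ... /\ x_n = eps(s) x_(s 1) /\ ... /\ x_(s n), where    *)
(* d i = |x_i|: a factor (-1)^(|x_a| |x_b|) for each pair of letters which s  *)
(* puts in the opposite order. koszul_signP below proves the identity for all *)
(* graded commuting families in an algebra.                                   *)
Definition koszul_sign s : K :=
  \prod_(p < n) \prod_(q < n | ((p < q) && (s q < s p))%N)
    (-1) ^ (d (s p) * d (s q)).

Definition chi s : K := (-1) ^+ s * koszul_sign s.

(* s \in S_{i, n - i} *)
Definition shuffle (i : nat) s : bool :=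
  [forall p : 'I_n, forall q : 'I_n,
     ((p < q < i) || (i <= p < q))%N ==> (s p < s q)%N].

Definition fixes_first s : bool :=
  [forall p : 'I_n, (p == 0 :> nat)%N ==> (s p == 0 :> nat)%N].

End Signs.

Section KoszulSign.
Variables (K : fieldType) (A : algType K) (n : nat).
Variables (d : 'I_n -> int) (x : 'I_n -> A).
Hypothesis xC : forall i j, x i * x j = (-1) ^ (d i * d j) *: (x j * x i).

Let sg a b : K := (-1) ^ (d a * d b).

Let sgM a b : sg a b * sg a b = 1.
Proof. by rewrite /sg -expfzMl mulrNN mulr1 exp1rz. Qed.

Let prod_swap a (L : seq 'I_n) (P : pred 'I_n) :
  x a * \prod_(i <- L | P i) x i
    = (\prod_(i <- L | P i) sg a i) *: (\prod_(i <- L | P i) x i * x a).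
Proof.
rewrite -!(big_filter L P); elim: (filter P L) => [|b M IH].
  by rewrite !big_nil mulr1 mul1r scale1r.
by rewrite !big_cons mulrA xC -scalerAl -[x b * x a * _]mulrA IH -scalerAr scalerA mulrA.
Qed.

Let lt_enum : pairwise (fun i j : 'I_n => (i < j)%N) (enum 'I_n).
Proof.
have := iota_ltn_sorted 0 n; rewrite -val_enum_ord (sorted_pairwise ltn_trans).
by rewrite pairwise_map.
Qed.

Let enum_split (a : 'I_n) : exists L R, [/\ enum 'I_n = L ++ a :: R,
  all (fun i : 'I_n => (i < a)%N) L & all (fun i : 'I_n => (a < i)%N) R].
Proof.
have := lt_enum; case/splitPr: (mem_enum 'I_n a) => L R.
rewrite pairwise_cat allrel_consr /= => /and3P[/andP[La _] _ /andP[aR _]].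
by exists L, R; split.
Qed.

Let insert a (w : seq 'I_n) : uniq (a :: w) ->
  x a * \prod_(i <- enum 'I_n | i \in w) x i
    = (\prod_(b <- w | (b < a)%N) sg a b)
        *: \prod_(i <- enum 'I_n | i \in a :: w) x i.
Proof.
move=> /= /andP[aw uw]; have [L [R [E /allP La /allP aR]]] := enum_split a.
have uE : uniq (L ++ a :: R) by rewrite -E enum_uniq.
have -> : \prod_(b <- w | (b < a)%N) sg a b = \prod_(i <- L | i \in w) sg a i.
  rewrite -big_filter -[RHS]big_filter; apply: perm_big; apply: uniq_perm.
  - exact: filter_uniq.
  - by apply: filter_uniq; move: uE; rewrite cat_uniq => /and3P[].
  move=> i; rewrite !mem_filter andbC; case: (i \in w) => //=.
  have : i \in L ++ a :: R by rewrite -E mem_enum.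
  rewrite mem_cat inE => /or3P[iL|/eqP->|iR]; first by rewrite iL La.
    rewrite ltnn; apply/esym/negbTE/negP => aL.
    by have := La _ aL; rewrite ltnn.
  have ai := aR _ iR; rewrite ltnNge (ltnW ai) /=; apply/esym/negbTE/negP => iL.
  by have := La _ iL; rewrite ltnNge (ltnW ai).
rewrite E !big_cat !big_cons /= inE eqxx (negbTE aw) /= mulrA prod_swap.
have outside M : {in M, forall i, i != a} ->
    \prod_(i <- M | i \in a :: w) x i = \prod_(i <- M | i \in w) x i.
  move=> Ma; rewrite big_seq_cond [RHS]big_seq_cond; apply: eq_bigl => i.
  by case: (boolP (i \in M)) => //= /Ma ia; rewrite inE (negbTE ia).
rewrite !outside -?scalerAl ?mulrA //.
  by move=> i /aR ai; apply: contraTneq ai => ->; rewrite ltnn.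
by move=> i /La ai; apply: contraTneq ai => ->; rewrite ltnn.
Qed.

Let sgn (s : 'S_n) (l : seq 'I_n) : K :=
  \prod_(p <- l) \prod_(q <- l | ((p < q) && (s q < s p))%N) sg (s p) (s q).

Let sort_word (s : 'S_n) (l : seq 'I_n) :
    pairwise (fun i j : 'I_n => (i < j)%N) l ->
  \prod_(p <- l) x (s p)
    = sgn s l *: \prod_(i <- enum 'I_n | i \in map s l) x i.
Proof.
elim: l => [|a l IH] /=; first by rewrite /sgn !big_nil big_pred0_eq scale1r.
case/andP=> /allP al lP.
have aNl : a \notin l by apply/negP => /al; rewrite ltnn.
have ul : uniq l.
  apply: (pairwise_uniq (r := fun i j : 'I_n => (i < j)%N)) lP.
  by move=> i; rewrite ltnn.
have us : uniq (s a :: map s l).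
  by rewrite /= mem_map ?aNl ?map_inj_uniq //; exact: perm_inj.
rewrite big_cons IH // -scalerAr (insert us) scalerA big_map.
congr (_ *: _); rewrite /sgn big_cons mulrC big_cons ltnn /=; congr (_ * _).
  rewrite big_seq_cond [RHS]big_seq_cond; apply: eq_bigl => q.
  by case: (boolP (q \in l)) => //= /al ->.
apply: eq_big_seq => p /al ap; rewrite big_cons.
by rewrite ltnNge (ltnW ap).
Qed.

Lemma koszul_signP (s : 'S_n) :
  \prod_(i < n) x i = koszul_sign K d s *: \prod_(i < n) x (s i).
Proof.
have enE : index_enum 'I_n = enum 'I_n by rewrite enumT; unlock index_enum.
rewrite !enE (sort_word s lt_enum).
have -> : \prod_(i <- enum 'I_n | i \in map s (enum 'I_n)) x i
    = \prod_(i <- enum 'I_n) x i.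
  apply: eq_bigl => i.
  by rewrite -[i](permKV s) mem_map ?mem_enum //; apply: perm_inj.
rewrite scalerA.
have -> : sgn s (enum 'I_n) = koszul_sign K d s.
  rewrite /sgn /koszul_sign big_enum; apply: eq_bigr => p _.
  by rewrite big_enum_cond.
suff -> : koszul_sign K d s * koszul_sign K d s = 1 by rewrite scale1r.
rewrite /koszul_sign -big_split big1 // => p _.
by rewrite -big_split big1 // => q _; apply: sgM.
Qed.

End KoszulSign.

Section Multilinear.
Variables (K : fieldType) (n : nat).

(* A linear map on the n-fold tensor power of V is encoded as an n-linear map *)
(* on families 'I_n -> V.                                                     *)
Definition multilinear (V W : lmodType K) (f : ('I_n -> V) -> W) : Prop :=
  forall (xi : 'I_n -> V) (p : 'I_n) (a : K) (u v : V),
    f [eta xi with p |-> a *: u + v]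
      = a *: f [eta xi with p |-> u] + f [eta xi with p |-> v].

Variables V W : gradedLmodType K.
Implicit Types (f : ('I_n -> V) -> W) (xi : 'I_n -> V) (d : 'I_n -> int).

Definition homog_word xi d : Prop := forall p, xi p \in homog (d p).

Definition has_degree (e : int) f : Prop :=
  forall xi d, homog_word xi d -> f xi \in homog (\sum_(p < n) d p + e).

Definition skew_symmetric f : Prop :=
  forall xi d (s : 'S_n), homog_word xi d ->
    f (fun p => xi (s p)) = chi K d s *: f xi.

Definition skew_graded_map (e : int) f : Prop :=
  [/\ multilinear f, has_degree e f & skew_symmetric f].

End Multilinear.

(* A sequence of n-ary operations, one for each n; the values at arities      *)
(* which an equation does not mention are irrelevant.                         *)
Definition operations (V W : Type) : Type := forall n, ('I_n -> V) -> W.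

Definition set_operation (V W : Type) (f : operations V W) m
    (fm : ('I_m -> V) -> W) : operations V W :=
  @dfwith nat (fun n => ('I_n -> V) -> W) f m fm.

(* h(w_1, ..., w_j), for a word w of length j *)
Definition app (V : zmodType) (W : Type) j (h : ('I_j -> V) -> W) (w : seq V) : W :=
  h (fun p : 'I_j => w`_p).

(* the word xi_(s 1), ..., xi_(s n) *)
Definition word (V : Type) n (xi : 'I_n -> V) (s : 'S_n) : seq V :=
  [seq xi (s p) | p <- enum 'I_n].

Section HigherBrackets.
Variables (K : fieldType) (g : dgLieType K).
Local Notation H := (cohomology g).

Variables (l : operations H H) (f : operations H g).

Definition starts_with (f1 : H -> g) : Prop :=
  @l 1 = (fun=> 0) /\ @f 1 = (fun xi => f1 (xi ord0)).

Variable n : nat.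

Definition equationJ : Prop :=
  forall (xi : 'I_n -> H) (d : 'I_n -> int), homog_word xi d ->
    \sum_(2 <= i < n.+1) \sum_(2 <= j < n.+1 | (i + j == n.+1)%N)
      \sum_(s : 'S_n | shuffle i s)
        (chi K d s * (-1) ^+ (i * j.-1)) *:
          app (@l j) (app (@l i) (take i (word xi s)) :: drop i (word xi s))
    = 0.

Definition e_sign (d : 'I_n -> int) (s t : nat) (tau : 'S_n) : K :=
  (-1) ^+ s.-1 * (-1) ^ (t.-1%:Z * \sum_(p < n | (p < s)%N) d (tau p)).

Definition termT (xi : 'I_n -> H) (d : 'I_n -> int) : g :=
  \sum_(2 <= j < n.+1) \sum_(2 <= k < n.+1 | (j + k == n.+1)%N)
    \sum_(s : 'S_n | shuffle k s)
      (chi K d s * (-1) ^+ (k * j.-1)) *: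
        app (@f j) (app (@l k) (take k (word xi s)) :: drop k (word xi s))
  - \sum_(1 <= s < n.+1) \sum_(1 <= t < n.+1 | (s + t == n)%N)
      \sum_(tau : 'S_n | shuffle s tau && fixes_first tau)
        (chi K d tau * e_sign d s t tau) *:
          bracket (app (@f s) (take s (word xi tau)))
                  (app (@f t) (drop s (word xi tau))).

Definition equationE : Prop :=
  forall (xi : 'I_n -> H) (d : 'I_n -> int), homog_word xi d ->
    diff (f xi) - app (@f 1) [:: l xi] = termT xi d.

End HigherBrackets.

(* A family b indexed by a possibly infinite set, with values in the subspace *)
(* P, is a basis of P.                                                        *)
Definition basis_of_sub (K : fieldType) (V : lmodType K) (P : {pred V})
    (I : eqType) (b : I -> V) : Prop :=
  [/\ forall i, b i \in P,
      forall (s : seq I) (c : I -> K), uniq s ->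
        \sum_(i <- s) c i *: b i = 0 -> {in s, forall i, c i = 0}
    & forall v, v \in P -> exists (s : seq I) (c : I -> K),
        v = \sum_(i <- s) c i *: b i].

(* Main.v *)
Require Import Defs.
From HB Require Import structures.
From mathcomp Require Import all_boot all_order all_fingroup all_algebra.
From mathcomp Require Import boolp ring zify.

Set Implicit Arguments.
Unset Strict Implicit.
Unset Printing Implicit Defensive.

Import GRing.Theory.
Local Open Scope ring_scope.

(* Desuspending (shifting degrees by 1, twisting by (-1)^(sum (n-i)|x_i|))    *)
(* turns the skew-symmetric maps into Koszul symmetric ones, l_n into maps of *)
(* degree 1 and f_n into maps of degree 0. Write L and F for the families of  *)
(* desuspended maps, and L(A), F(A) for their values on a word A. In terms of *)
(* the unshuffle coproduct w |-> sum A (x) B, (J_n) says that the sum of      *)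
(* L(L(A), B) vanishes, and (E_n) that d F(w) = sum F(L(A), B)                *)
(* - 1/2 sum b(F(A), F(B)), b being the desuspended bracket. If (E_k) and     *)
(* (J_k) hold for k < n, applying d to the known part T_n of the right-hand   *)
(* side of (E_n) gives d T_n = f_1(J_n), by coassociativity, cocommutativity  *)
(* and the Jacobi identity. As f_1(h) is exact only for h = 0, (J_n) follows, *)
(* so that T_n is a cocycle; l_n is minus its class, and a primitive of       *)
(* T_n + f_1 l_n, chosen on a basis and then symmetrized (here characteristic *)
(* 0 is used) and extended multilinearly, is f_n.                             *)

(** * The unshuffle coproduct *)

(** Solving (E_n) for (l_n, f_n) amounts to writing T_n as a boundary minus f_1 of a class, which is
    possible exactly when T_n is a cocycle: l_n is then minus the class of T_n, and f_n is a
    primitive. Everything rests on the identity d T_n = f_1(J_n), valid once the equations of lower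
    arity hold, where J_n is the left-hand side of (J_n); on words this is [diff_morphism_defect].
    It is used in two ways. Read from left to right, it says that f_1(J_n) is exact; as f_1 picks
    representatives, J_n = 0 ([equationJ_top], applied at n = 3 and n = m + 1). If (J_n) is already
    known, it says that T_n is a cocycle ([defect_cocycle]), and the next operations exist
    ([exists_next], applied at n = 2 and n = m).

    In the identity, [diff_insert] and [diff_lie_term] differentiate the two parts of T_n.
    Insertions of two separate values of L cancel by symmetry ([insert_insert_eq0]), triple brackets
    by Jacobi ([triple_bracket_eq0]), and nested insertions add up to the Jacobiator
    ([insert_jacobiator]).

    The passage from sums over permutations to the coproduct is [sum_shuffle]: the first letter of a
    word heads one of the two blocks of a shuffle, which is the recursion of [unshuffle], and
    [twist] absorbs the difference between chi and the Koszul sign of the desuspension. This turns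
    the given equations into [equationJ_jacobiator] and [morphism_sum_defect].

    For existence, [basis_values] solves the equation on words of basis vectors. The class is
    symmetric because T_n determines it; the primitive is not unique and is averaged over
    permutations. Multilinear extension then reaches all homogeneous words by [slot_ind]. *)

Definition sgn (V : zmodType) (b : bool) (v : V) : V := if b then - v else v.

Section Sign.
Variable V : zmodType.
Implicit Types (b c : bool) (u v : V).

Lemma sgn_sgn b c v : sgn b (sgn c v) = sgn (b (+) c) v.
Proof. by case: b c => [] [] //=; rewrite opprK. Qed.

Lemma sgnD b u v : sgn b (u + v) = sgn b u + sgn b v.
Proof. by case: b => //=; rewrite opprD. Qed.

Lemma sgnN b v : sgn b (- v) = - sgn b v.
Proof. by case: b. Qed.

Lemma sgn0 b : sgn b (0 : V) = 0.
Proof. by case: b => //=; rewrite oppr0. Qed.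

(** Stated for a bare function because it is mostly applied to one slot of an operation. *)
Lemma sgn_fun (W : zmodType) (h : V -> W) b v :
  zmod_morphism h -> h (sgn b v) = sgn b (h v).
Proof.
move=> hB; case: b => //=.
have h0 : h 0 = 0 by rewrite -(subrr 0) hB subrr.
by rewrite -sub0r hB h0 sub0r.
Qed.

End Sign.

Section SignScale.
Variables (K : fieldType) (V : lmodType K).
Implicit Types (b : bool) (v : V).

Lemma sgnZ b (a : K) v : sgn b (a *: v) = a *: sgn b v.
Proof. by case: b => //=; rewrite scalerN. Qed.

Lemma sgnE b v : sgn b v = (-1) ^+ b *: v.
Proof. by case: b => /=; rewrite ?expr1 ?expr0 ?scaleN1r ?scale1r. Qed.

Lemma scale_exprN1 n v : (-1) ^+ n *: v = sgn (odd n) v.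
Proof. by rewrite sgnE signr_odd. Qed.

Lemma rpred_sgn (S : submodClosed V) b v : v \in S -> sgn b v \in S.
Proof. by rewrite sgnE; apply: rpredZ. Qed.

End SignScale.

Section Unshuffle.
Variables (X : eqType) (par : X -> bool).
Implicit Types (w A B C D : seq X).

Definition word_par w := \big[addb/false]_(x <- w) par x.

Lemma word_par_cons x w : word_par (x :: w) = par x (+) word_par w.
Proof. by rewrite /word_par big_cons. Qed.

Lemma word_par_cat A B : word_par (A ++ B) = word_par A (+) word_par B.
Proof. by rewrite /word_par big_cat. Qed.

Lemma word_par_perm A B : perm_eq A B -> word_par A = word_par B.
Proof. by move=> AB; apply: perm_big. Qed.

(* The unshuffle coproduct of the graded symmetric coalgebra, in recursive    *)
(* form: the head of the word goes to the head of the left or of the right    *)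
(* block.                                                                     *)
Fixpoint unshuffle (W : zmodType) w (Phi : seq X -> seq X -> W) : W :=
  if w is x :: w' then
    unshuffle w' (fun A B => Phi (x :: A) B)
    + unshuffle w' (fun A B => sgn (par x && word_par A) (Phi A (x :: B)))
  else Phi [::] [::].

(** The permutation hypothesis is what carries homogeneity, parity and length of [w] over to the two
    blocks. *)
Lemma eq_unshuffle (W : zmodType) w (Phi Psi : seq X -> seq X -> W) :
  (forall A B, perm_eq (A ++ B) w -> Phi A B = Psi A B) ->
  unshuffle w Phi = unshuffle w Psi.
Proof.
elim: w Phi Psi => [|x w IH] Phi Psi eqP /=; first exact: eqP.
congr (_ + _); apply: IH => A B AB; first by rewrite eqP //= perm_cons.
by rewrite eqP // -cat1s perm_catCA perm_cons.
Qed.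

Lemma unshuffleD (W : zmodType) w (Phi Psi : seq X -> seq X -> W) :
  unshuffle w (fun A B => Phi A B + Psi A B)
    = unshuffle w Phi + unshuffle w Psi.
Proof.
elim: w Phi Psi => [|x w IH] Phi Psi //=; rewrite IH addrACA; congr (_ + _).
by rewrite -IH; apply: eq_unshuffle => A B _; rewrite sgnD.
Qed.

Lemma unshuffle_fun (W W' : zmodType) (h : W -> W') w Phi : zmod_morphism h ->
  h (unshuffle w Phi) = unshuffle w (fun A B => h (Phi A B)).
Proof.
move=> hB; have hD u v : h (u + v) = h u + h v.
  have hN z : h (- z) = - h z by rewrite (sgn_fun true z hB).
  by rewrite -{1}[v]opprK hB hN opprK.
elim: w Phi => [|x w IH] Phi //=; rewrite hD !IH; congr (_ + _).
by apply: eq_unshuffle => A B _; rewrite sgn_fun.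
Qed.

Lemma sgn_unshuffle (W : zmodType) b w (Phi : seq X -> seq X -> W) :
  sgn b (unshuffle w Phi) = unshuffle w (fun A B => sgn b (Phi A B)).
Proof. by apply: unshuffle_fun => u v; rewrite sgnD sgnN. Qed.

Lemma unshuffleN (W : zmodType) w (Phi : seq X -> seq X -> W) :
  unshuffle w (fun A B => - Phi A B) = - unshuffle w Phi.
Proof. by rewrite -[RHS]/(sgn true _) sgn_unshuffle. Qed.

Lemma unshuffle0 (W : zmodType) w : unshuffle w (fun _ _ => 0) = 0 :> W.
Proof.
elim: w => //= x w IH; rewrite IH add0r -[RHS]IH.
by apply: eq_unshuffle => A B _; rewrite sgn0.
Qed.

Lemma unshuffle_sum (W : zmodType) (I : Type) (r : seq I) (P : pred I) w
    (Phi : I -> seq X -> seq X -> W) :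
  \sum_(i <- r | P i) unshuffle w (Phi i)
    = unshuffle w (fun A B => \sum_(i <- r | P i) Phi i A B).
Proof.
rewrite -[LHS]big_filter; elim: r => [|i r IH] /=.
  rewrite big_nil -[LHS](unshuffle0 W w).
  by apply: eq_unshuffle => A B _; rewrite big_nil.
case: ifP => Pi.
  rewrite big_cons IH -unshuffleD; apply: eq_unshuffle => A B _.
  by rewrite big_cons Pi.
by rewrite IH; apply: eq_unshuffle => A B _; rewrite big_cons Pi.
Qed.

(** Exchanging the blocks exchanges the two branches of the recursion; the sign is that of moving
    one block past the other. *)
Lemma unshuffle_cocomm (W : zmodType) w (Phi : seq X -> seq X -> W) :
  unshuffle w Phi = unshuffle w (fun A B => sgn (word_par A && word_par B) (Phi B A)).
Proof.
elim: w Phi => [|x w IH] Phi /=; first by rewrite /word_par big_nil.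
rewrite addrC; congr (_ + _); rewrite IH; apply: eq_unshuffle => A B _;
  rewrite !sgn_sgn word_par_cons; congr (sgn _ _);
  by case: (par x) (word_par A) (word_par B) => [] [] [].
Qed.

(** Both sides distribute the letters among three blocks, and the three choices for the head match
    one by one. *)
Lemma unshuffle_coassoc (W : zmodType) w (Phi : seq X -> seq X -> seq X -> W) :
  unshuffle w (fun Y D => unshuffle Y (fun A C => Phi A C D))
    = unshuffle w (fun A Y => unshuffle Y (fun C D => Phi A C D)).
Proof.
elim: w Phi => [|x w IH] Phi //=; rewrite !unshuffleD -addrA; congr (_ + _).
  exact: IH.
under [RHS]eq_unshuffle => A B _ do rewrite sgnD.
rewrite unshuffleD; congr (_ + _).
  rewrite IH; apply: eq_unshuffle => A B _.
  exact/esym/sgn_unshuffle.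
(* The head goes to the third block: its sign past the first two blocks together is the product of
   its signs past each. *)
under eq_unshuffle => A B _.
  rewrite sgn_unshuffle.
  under eq_unshuffle => C D CD.
    rewrite -(word_par_perm CD) word_par_cat andb_addr -sgn_sgn. over.
  over.
rewrite (IH (fun C D B => sgn (par x && word_par C)
  (sgn (par x && word_par D) (Phi C D (x :: B))))).
by apply: eq_unshuffle => A B _; rewrite sgn_unshuffle.
Qed.

(* Koszul symmetry under adjacent transpositions of a word function, on the   *)
(* words all of whose letters satisfy hw.                                     *)
Definition swap_sym (W : zmodType) (hw : pred X) (Psi : seq X -> W) : Prop :=
  forall A x y B, all hw (A ++ x :: y :: B) ->
    Psi (A ++ x :: y :: B) = sgn (par x && par y) (Psi (A ++ y :: x :: B)).

(** If both swapped letters land in the same block, the symmetry of [Phi] in that block applies; if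
    they land in different blocks, the swap exchanges two terms, and the coproduct itself supplies
    the sign. *)
Lemma unshuffle_sym (W : zmodType) (hw : pred X) (Phi : seq X -> seq X -> W) :
  (forall A, all hw A -> swap_sym hw (Phi A)) ->
  (forall B, all hw B -> swap_sym hw (Phi^~ B)) ->
  swap_sym hw (fun w => unshuffle w Phi).
Proof.
move=> symR symL u x y v; elim: u Phi symR symL => [|z u IH] Phi symR symL.
  rewrite /= => /and3P[hx hy hv].
  have hall A B : perm_eq (A ++ B) v -> all hw A && all hw B.
    by move=> AB; rewrite -all_cat (perm_all _ AB).
  rewrite !sgnD !sgn_unshuffle [RHS]addrACA; congr (_ + _ + (_ + _));
    apply: eq_unshuffle => A B /hall/andP[hA hB].
  - by rewrite (symL B hB [::] x y A) //= hx hy.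
  - rewrite word_par_cons sgn_sgn; congr sgn.
    by case: (par x) (par y) (word_par A) => [] [] [].
  - rewrite word_par_cons sgn_sgn; congr sgn.
    by case: (par x) (par y) (word_par A) => [] [] [].
  - rewrite (symR A hA [::] x y B) ?sgn_sgn /= ?hx ?hy //.
    by congr sgn; case: (par x) (par y) (word_par A) => [] [] [].
rewrite /= => /andP[hz hw_]; rewrite sgnD; congr (_ + _).
  by apply: IH => // [A hA|B hB] a p q b hab; [apply: symR => /=; rewrite ?hz
     | apply: (symL _ hB (z :: a)); rewrite /= hz].
apply: IH => // [A hA|B hB] a p q b hab.
  by rewrite (symR A hA (z :: a)) /= ?hz // !sgn_sgn addbC.
rewrite symL /= ?hz // !sgn_sgn !word_par_cat !word_par_cons; congr sgn.
by case: (par p) (par q) (par z) (word_par a) (word_par b) => [] [] [] [] [].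
Qed.

End Unshuffle.

Section UnshuffleSymmetry.
Variables (X : eqType) (par : X -> bool).
Implicit Types (w A B C D : seq X).
Local Notation wpar := (word_par par).
Local Notation unshuffle := (unshuffle par).

(** Produces the cyclic rotations of three blocks that occur in the Jacobi identity. *)
Lemma unshuffle_cyclic (W : zmodType) w (Phi : seq X -> seq X -> seq X -> W) :
  unshuffle w (fun Y D => unshuffle Y (fun A C => Phi A C D))
    = unshuffle w (fun Y D => unshuffle Y (fun A C =>
        sgn (wpar D && (wpar A (+) wpar C)) (Phi D A C))).
Proof.
rewrite unshuffle_coassoc unshuffle_cocomm; apply: eq_unshuffle => Y D _.
rewrite sgn_unshuffle; apply: eq_unshuffle => A C ACY.
by rewrite -(word_par_perm par ACY) word_par_cat andbC.
Qed.

(** The counit: it lets a single value be compared term by term with a sum over splittings. *)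
Lemma unshuffle_left (W : zmodType) w (Psi : seq X -> W) :
  unshuffle w (fun A B => if nilp B then Psi A else 0) = Psi w.
Proof.
elim: w Psi => [|x w IH] Psi //=; rewrite IH.
under eq_unshuffle => A B _ do rewrite sgn0.
by rewrite unshuffle0 addr0.
Qed.

End UnshuffleSymmetry.

(** * Letters and the desuspended bracket *)

Definition oddz (z : int) : bool := odd `|z|%N.

Lemma oddzN z : oddz (- z) = oddz z.
Proof. by rewrite /oddz abszN. Qed.

Lemma oddzD y z : oddz (y + z) = oddz y (+) oddz z.
Proof.
have oddB (m n : nat) : oddz (m%:Z - n%:Z) = odd m (+) odd n.
  rewrite /oddz; case: (leqP n m) => mn; first by rewrite subzn //= oddB.
  by rewrite -opprB abszN subzn 1?ltnW //= oddB 1?ltnW // addbC.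
case: y z => m [] n; rewrite ?NegzE ?oddzN.
- by rewrite -PoszD /oddz /= oddD.
- exact: oddB.
- by rewrite addrC oddB addbC.
- by rewrite -opprD oddzN -PoszD; apply: oddD.
Qed.

Lemma oddzM y z : oddz (y * z) = oddz y && oddz z.
Proof. by rewrite /oddz abszM oddM. Qed.

Lemma exprN1_oddz (K : fieldType) z : (-1 : K) ^ z = (-1) ^+ oddz z.
Proof.
rewrite /oddz signr_odd; case: z => n //=.
by rewrite NegzE -exprz_inv invrN invr1.
Qed.

Section Letters.
Variables (K : fieldType) (V : gradedLmodType K).
Implicit Types (w A B C D : seq (V * int)).

(* A letter is an element together with its degree; its Koszul parity is the  *)
(* one of the desuspended element.                                            *)
Definition par (x : V * int) : bool := ~~ oddz x.2.
Definition homog_letter (x : V * int) : bool := x.1 \in homog x.2.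
Definition sdeg w : int := \sum_(x <- w) (x.2 - 1).

Local Notation wpar := (word_par par).
Local Notation unshuffle := (unshuffle par).
Local Notation hw := (all homog_letter).

Lemma oddz_sdeg w : oddz (sdeg w) = wpar w.
Proof.
rewrite /sdeg /word_par; elim: w => [|x w IH]; first by rewrite !big_nil.
by rewrite !big_cons oddzD IH oddzD addbT.
Qed.

Lemma sdeg_cons x w : sdeg (x :: w) = x.2 - 1 + sdeg w.
Proof. by rewrite /sdeg big_cons. Qed.

Lemma sdeg_cat A B : sdeg (A ++ B) = sdeg A + sdeg B.
Proof. by rewrite /sdeg big_cat. Qed.

Lemma sdeg_perm A B : perm_eq A B -> sdeg A = sdeg B.
Proof. by move=> AB; apply: perm_big. Qed.

(** The degree label of the slot is held fixed and may differ from the true degree of the vector put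
    there. *)
Definition slot_linear (W : lmodType K) (Psi : seq (V * int) -> W) : Prop :=
  forall A B d a u v,
    Psi (A ++ (a *: u + v, d) :: B)
      = a *: Psi (A ++ (u, d) :: B) + Psi (A ++ (v, d) :: B).

Lemma slot_linear0 (W : lmodType K) (Psi : seq (V * int) -> W) A B d :
  slot_linear Psi -> Psi (A ++ (0, d) :: B) = 0.
Proof.
move=> lin; have := lin A B d (-1) 0 0.
by rewrite scaler0 addr0 scaleN1r addNr.
Qed.

Lemma unshuffle_scale (W : lmodType K) (a : K) w
    (Phi : seq (V * int) -> seq (V * int) -> W) :
  unshuffle w (fun A B => a *: Phi A B) = a *: unshuffle w Phi.
Proof. by rewrite (@unshuffle_fun _ _ _ _ ( *:%R a)) // => u v; rewrite scalerBr. Qed.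

Lemma unshuffle_slot_linear (W : lmodType K)
    (Phi : seq (V * int) -> seq (V * int) -> W) :
  (forall A, slot_linear (Phi A)) -> (forall B, slot_linear (Phi^~ B)) ->
  slot_linear (fun w => unshuffle w Phi).
Proof.
move=> linR linL A v d a x y; elim: A Phi linR linL => [|z u IH] Phi linR linL.
  rewrite /= scalerDr [RHS]addrACA -!unshuffle_scale -!unshuffleD.
  apply: eq_unshuffle => A B _; congr (_ + _); first exact: (linL B [::] A).
  by rewrite (linR A [::] B) /= sgnD sgnZ.
rewrite /= scalerDr [RHS]addrACA; congr (_ + _); apply: IH.
- by move=> A; apply: linR.
- by move=> B C D; apply: (linL B (z :: C) D).
- by move=> A C D b e p q; rewrite (linR A (z :: C)) sgnD sgnZ.
- move=> B C D b e p q; rewrite linL sgnD sgnZ.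
  by rewrite !word_par_cat !word_par_cons.
Qed.

End Letters.

Section Bracket.
Variables (K : fieldType) (g : dgLieType K).
Implicit Types (u v w : g).

Lemma bracketBl u1 u2 v : bracket (u1 - u2) v = bracket u1 v - bracket u2 v.
Proof. by rewrite addrC -scaleN1r bracket_linearl scaleN1r addrC. Qed.

Lemma bracketBr u v1 v2 : bracket u (v1 - v2) = bracket u v1 - bracket u v2.
Proof. by rewrite addrC -scaleN1r bracket_linearr scaleN1r addrC. Qed.

Lemma bracket0l v : bracket 0 v = 0 :> g.
Proof. by have := bracketBl 0 0 v; rewrite !subrr. Qed.

Lemma bracket0r v : bracket v 0 = 0 :> g.
Proof. by have := bracketBr v 0 0; rewrite !subrr. Qed.

Lemma sgn_bracketl b u v : bracket (sgn b u) v = sgn b (bracket u v).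
Proof. by apply: (sgn_fun (h := bracket^~ v)) => x y; apply: bracketBl. Qed.

Lemma sgn_bracketr b u v : bracket u (sgn b v) = sgn b (bracket u v).
Proof. by apply: (sgn_fun (h := bracket u)) => x y; apply: bracketBr. Qed.

Lemma bracketC i j u v : u \in homog i -> v \in homog j ->
  bracket u v = sgn (~~ (oddz i && oddz j)) (bracket v u).
Proof.
move=> hu hv; rewrite (bracket_skew _ _ _ _ hu hv) exprN1_oddz oddzM -sgnE.
by case: (_ && _); rewrite /= ?opprK.
Qed.

(* The desuspended bracket (-1)^|u| [u, v], where p is the parity of |u| - 1. *)
Definition sbracket (p : bool) u v : g := sgn (~~ p) (bracket u v).

Lemma diff_sbracket i u v : u \in homog i -> forall j, v \in homog j ->
  diff (sbracket (~~ oddz i) u v)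
    = - sbracket (oddz i) (diff u) v - sgn (~~ oddz i) (sbracket (~~ oddz i) u (diff v)).
Proof.
move=> hu j hv; rewrite /sbracket (sgn_fun (h := @diff K g)); last exact: raddfB.
rewrite (diff_bracket _ _ _ _ hu hv) exprN1_oddz -sgnE sgnD !sgn_sgn.
by case: (oddz i) => /=; rewrite ?opprK.
Qed.

(** The factor (-1)^|u| turns graded antisymmetry into Koszul symmetry for the shifted degrees. *)
Lemma sbracketC i j u v : u \in homog i -> v \in homog j ->
  sbracket (~~ oddz i) u v
    = sgn (~~ oddz i && ~~ oddz j) (sbracket (~~ oddz j) v u).
Proof.
move=> hu hv; rewrite /sbracket (bracketC hu hv) !sgn_sgn.
by case: (oddz i) (oddz j) => [] [].
Qed.

(* Graded symmetric form of the Jacobi identity, p, q, r being the parities   *)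
(* of the desuspended u, v, w.                                                *)
Lemma sbracket_jacobi i j k u v w (p := ~~ oddz i) (q := ~~ oddz j) (r := ~~ oddz k) :
  u \in homog i -> v \in homog j -> w \in homog k ->
  sbracket (~~ (p (+) q)) (sbracket p u v) w
  + sgn (r && (p (+) q)) (sbracket (~~ (r (+) p)) (sbracket r w u) v)
  + sgn (p && (q (+) r)) (sbracket (~~ (q (+) r)) (sbracket q v w) u) = 0.
Proof.
move=> hu hv hw; rewrite /sbracket !sgn_bracketl !sgn_sgn.
have hvw := bracket_degree _ _ _ _ hv hw.
have hvu := bracket_degree _ _ _ _ hu hw.
have := bracket_jacobi _ _ _ _ _ _ hu hv hw.
rewrite (bracketC hu hvw) (bracketC hv hvu) (bracketC hu hw).
rewrite sgn_bracketl !exprN1_oddz oddzM -sgnE !sgn_sgn !oddzD /p /q /r.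
case: (oddz i) (oddz j) (oddz k) => [] [] [] /=; rewrite ?opprK => J;
  by [ rewrite -J ?subrr ?addNr
     | apply: oppr_inj; rewrite oppr0 !opprD ?opprK -J ?subrr ?addNr].
Qed.

End Bracket.

(** * The differential of the obstruction *)

Section Obstruction.
Variables (K : fieldType) (charK : [pchar K] =i pred0).
Variables (V : gradedLmodType K) (g : dgLieType K).
Implicit Types (w A B C D Y : seq (V * int)).

Local Notation wpar := (word_par (@par K V)).
Local Notation unshuffle := (unshuffle (@par K V)).
Local Notation hw := (all (@homog_letter K V)).

Variables (L : seq (V * int) -> V) (F : seq (V * int) -> g).

(** [L] raises the shifted degree by 1, so the unshifted degree of [L A] is [sdeg A + 2]. *)
Definition letter A : V * int := (L A, sdeg A + 2).

Definition lie_term w : g :=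
  unshuffle w (fun A B => sbracket (wpar A) (F A) (F B)).

(* The two sides of the desuspended equation (E_n) are diff (F w) and         *)
(* morphism_defect w, the terms f_1(l_n w) and T_n of the former being put    *)
(* together.                                                                  *)
Definition morphism_defect w : g :=
  unshuffle w (fun A B => F (letter A :: B)) - 2%:R^-1 *: lie_term w.

Definition jacobiator w : V := unshuffle w (fun A B => L (letter A :: B)).

Hypothesis Llin : slot_linear L.
Hypothesis Flin : slot_linear F.
Hypothesis Lhomog : forall w, hw w -> L w \in homog (sdeg w + 2).
Hypothesis Fhomog : forall w, hw w -> F w \in homog (sdeg w + 1).

Lemma natf_neq0_char0 n : n.+1%:R != 0 :> K.
Proof. by rewrite (pcharf0P K).1. Qed.

Lemma double_eq0 (W : lmodType K) (z : W) : z = - z -> z = 0.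
Proof.
move=> zN; have : 2%:R *: z = 0 by rewrite scaler_nat mulr2n {2}zN subrr.
by move/eqP; rewrite scaler_eq0 (negbTE (natf_neq0_char0 1)) => /eqP.
Qed.

Lemma half_double (W : lmodType K) (z : W) : 2%:R^-1 *: (z + z) = z.
Proof.
by rewrite -mulr2n -scaler_nat scalerA mulVf ?scale1r // natf_neq0_char0.
Qed.

Lemma par_letter A : par (letter A) = ~~ wpar A.
Proof. by rewrite /par /= oddzD oddz_sdeg addbF. Qed.

Lemma homog_letterP A : hw A -> homog_letter (letter A).
Proof. exact: Lhomog. Qed.

Lemma word_par_odd w : wpar w = ~~ oddz (sdeg w + 1).
Proof. by rewrite oddzD oddz_sdeg addbT negbK. Qed.

Lemma sbracketFC A B : hw A -> hw B ->
  sbracket (wpar A) (F A) (F B)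
    = sgn (wpar A && wpar B) (sbracket (wpar B) (F B) (F A)).
Proof.
by move=> hA hB; rewrite !word_par_odd; apply: sbracketC; apply: Fhomog.
Qed.

Lemma sgn_sbracketl b p u v : sbracket p (sgn b u) v = sgn b (sbracket p u v) :> g.
Proof. by rewrite /sbracket sgn_bracketl !sgn_sgn addbC. Qed.

Lemma sgn_sbracketr b p u v : sbracket p u (sgn b v) = sgn b (sbracket p u v) :> g.
Proof. by rewrite /sbracket sgn_bracketr !sgn_sgn addbC. Qed.

Lemma sbracketBl p (v : g) : zmod_morphism ((@sbracket K g p)^~ v).
Proof. by move=> x y; rewrite /sbracket bracketBl sgnD sgnN. Qed.

Lemma sbracketDl p u1 u2 (v : g) :
  sbracket p (u1 + u2) v = sbracket p u1 v + sbracket p u2 v.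
Proof.
by rewrite -{1}[u2]opprK sbracketBl (sgn_fun true _ (sbracketBl p v)) opprK.
Qed.

Lemma sbracketZl p a (u v : g) : sbracket p (a *: u) v = a *: sbracket p u v.
Proof.
have := bracket_linearl v a u 0; rewrite addr0 bracket0l addr0 /sbracket => ->.
by rewrite sgnZ.
Qed.

Lemma sbracketZr p a (u v : g) : sbracket p u (a *: v) = a *: sbracket p u v.
Proof.
have := bracket_linearr u a v 0; rewrite addr0 bracket0r addr0 /sbracket => ->.
by rewrite sgnZ.
Qed.

Lemma sbracketDr p u (v1 v2 : g) :
  sbracket p u (v1 + v2) = sbracket p u v1 + sbracket p u v2.
Proof.
by have := bracket_linearr u 1 v1 v2; rewrite !scale1r /sbracket => ->; rewrite sgnD.
Qed.

Lemma sbracket0l p (v : g) : sbracket p 0 v = 0.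
Proof. by rewrite /sbracket bracket0l sgn0. Qed.

Lemma sbracket0r p (v : g) : sbracket p v 0 = 0.
Proof. by rewrite /sbracket bracket0r sgn0. Qed.

Lemma par_slot A x y d B : wpar (A ++ (x, d) :: B) = wpar (A ++ (y, d) :: B).
Proof. by rewrite !word_par_cat !word_par_cons. Qed.

Lemma sdeg_slot A (x y : V) d B :
  sdeg (A ++ (x, d) :: B) = sdeg (A ++ (y, d) :: B).
Proof. by rewrite !sdeg_cat !sdeg_cons. Qed.

Lemma insert_slot_linear (W : lmodType K) (G : seq (V * int) -> W) :
  slot_linear G -> slot_linear (fun w => unshuffle w (fun A B => G (letter A :: B))).
Proof.
move=> Glin; apply: unshuffle_slot_linear.
  by move=> A C D d a u v; apply: (Glin (letter A :: C)).
move=> B C D d a u v; rewrite /letter Llin (sdeg_slot C _ u).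
by rewrite (Glin [::] B) (sdeg_slot C u v).
Qed.

Lemma lie_term_slot_linear : slot_linear lie_term.
Proof.
apply: unshuffle_slot_linear => A C D d a u v.
  by rewrite Flin sbracketDr sbracketZr.
rewrite Flin sbracketDl sbracketZl; congr (_ *: sbracket _ _ _ + sbracket _ _ _).
  exact: par_slot.
exact: par_slot.
Qed.

Lemma morphism_defect_slot_linear : slot_linear morphism_defect.
Proof.
move=> A B d a u v; rewrite /morphism_defect lie_term_slot_linear.
rewrite (insert_slot_linear Flin) scalerDr scalerA mulrC -scalerA.
by rewrite opprD addrACA scalerBr.
Qed.

(* Since b is symmetric, the splittings which put the first letter in the     *)
(* left block, as in (E_n), contribute half of the sum.                       *)
Lemma half_lie_term_cons y B : homog_letter y -> hw B ->
  2%:R^-1 *: lie_term (y :: B) =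
    unshuffle B (fun C D => sbracket (wpar (y :: C)) (F (y :: C)) (F D)).
Proof.
move=> hy hB; rewrite /lie_term /= [X in _ *: (_ + X)]unshuffle_cocomm.
rewrite -[RHS]half_double; congr (_ *: (_ + _)).
apply: eq_unshuffle => C D CD.
have /andP[hC hD] : hw C && hw D by rewrite -all_cat (perm_all _ CD).
rewrite sbracketFC ?sgn_sgn //=; last by rewrite hy.
rewrite word_par_cons.
by case: (par y) (wpar C) (wpar D) => [] [] [].
Qed.

(** Applied with [y] itself a value of [L]: it separates nested insertions, insertions of two
    separate values, and brackets. *)
Lemma morphism_defect_cons y B : homog_letter y -> hw B ->
  morphism_defect (y :: B) =
    unshuffle B (fun C D => F (letter (y :: C) :: D))
    + unshuffle B (fun C D => sgn (par y && wpar C) (F (letter C :: y :: D)))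
    - unshuffle B (fun C D => sbracket (wpar (y :: C)) (F (y :: C)) (F D)).
Proof. by move=> hy hB; rewrite /morphism_defect half_lie_term_cons. Qed.

Variable n : nat.
Hypothesis Fnil : F [::] = 0.
Hypothesis Lsmall : forall w, (size w <= 1)%N -> L w = 0.
Hypothesis Fsym : forall x y B, all (@homog_letter K V) (x :: y :: B) ->
  F (x :: y :: B) = sgn (par x && par y) (F (y :: x :: B)).
Hypothesis Feq : forall w, hw w -> (size w < n)%N -> diff (F w) = morphism_defect w.
Hypothesis Leq : forall w, hw w -> (size w < n)%N -> jacobiator w = 0.

(** Where [L A] is nonzero, [A] has at least two letters, so inserting it shortens the word and the
    lower equations apply; where it is zero, both sides vanish by linearity. *)
Lemma diff_insert w : hw w -> size w = n ->
  diff (unshuffle w (fun A B => F (letter A :: B)))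
    = unshuffle w (fun A B => morphism_defect (letter A :: B)).
Proof.
move=> hw_ wn; rewrite (unshuffle_fun _ _ (h := @diff K g)); last exact: raddfB.
apply: eq_unshuffle => A B AB.
have /andP[hA hB] : hw A && hw B by rewrite -all_cat (perm_all _ AB).
have sAB : (size A + size B)%N = n by rewrite -size_cat (perm_size AB).
have [LA0|/eqP LA] := eqVneq (L A) 0.
  rewrite /letter LA0 (slot_linear0 [::] _ _ Flin) raddf0.
  by rewrite (slot_linear0 [::] _ _ morphism_defect_slot_linear).
apply: Feq => /=; first by rewrite homog_letterP.
rewrite -sAB ltnNge; apply/negP => AS; apply: LA; apply: Lsmall.
by rewrite -(leq_add2r (size B)) add1n.
Qed.

(** Grouped by [Y], the inner sum is [F] of the Jacobiator of [Y] followed by [D]; unless [D] is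
    empty, [Y] is short and its Jacobiator vanishes. *)
Lemma insert_jacobiator w : hw w -> size w = n ->
  unshuffle w (fun Y D => unshuffle Y (fun A C => F (letter (letter A :: C) :: D)))
    = F [:: (jacobiator w, sdeg w + 3)].
Proof.
move=> hw_ wn; rewrite -[RHS](unshuffle_left (@par K V) w
  (fun Y => F [:: (jacobiator Y, sdeg Y + 3)])).
apply: eq_unshuffle => Y D YD.
have /andP[hY hD] : hw Y && hw D by rewrite -all_cat (perm_all _ YD).
have sYD : (size Y + size D)%N = n by rewrite -size_cat (perm_size YD).
transitivity (F ((jacobiator Y, sdeg Y + 3) :: D)).
  rewrite (unshuffle_fun _ _ (h := fun x => F ((x, sdeg Y + 3) :: D))); last first.
    move=> u v; rewrite addrC -scaleN1r (Flin [::] D).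
    by rewrite scaleN1r addrC.
  apply: eq_unshuffle => A C ACY; congr (F ((_, _) :: _)).
  rewrite sdeg_cons -(sdeg_perm ACY) sdeg_cat /=; ring.
case: D sYD {YD hD} => [|x D] //= sYD.
rewrite (Leq hY); first exact: (slot_linear0 [::] _ _ Flin).
by rewrite -sYD addnS ltnS leq_addr.
Qed.

(** Since [L] is odd, exchanging the blocks [A] and [C] reverses the sign of each term. The sum
    equals its own negative. *)
Lemma insert_insert_eq0 w : hw w ->
  unshuffle w (fun A B => unshuffle B (fun C D =>
    sgn (par (letter A) && wpar C) (F (letter C :: letter A :: D)))) = 0.
Proof.
move=> hw_; apply: double_eq0.
rewrite -(unshuffle_coassoc _ w (fun A C D =>
  sgn (par (letter A) && wpar C) (F (letter C :: letter A :: D)))) -unshuffleN.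
apply: eq_unshuffle => Y D YD.
have /andP[hY hD] : hw Y && hw D by rewrite -all_cat (perm_all _ YD).
rewrite -unshuffleN [LHS]unshuffle_cocomm; apply: eq_unshuffle => A C ACY.
have /andP[hA hC] : hw A && hw C by rewrite -all_cat (perm_all _ ACY).
rewrite !par_letter Fsym /=; last by rewrite !homog_letterP.
rewrite !par_letter !sgn_sgn -[RHS]/(sgn true _) sgn_sgn.
by case: (wpar A) (wpar C) => [] [].
Qed.

(** The sum is invariant under cyclic rotation of its three blocks, so three copies of it form a sum
    of Jacobi expressions; 3 is invertible. *)
Lemma triple_bracket_eq0 w : hw w ->
  unshuffle w (fun Y D => sbracket (~~ wpar Y) (lie_term Y) (F D)) = 0.
Proof.
move=> hw_; set Z := unshuffle w _.
pose beta A C D := sbracket (~~ (wpar A (+) wpar C)) (sbracket (wpar A) (F A) (F C)) (F D).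
have Z1 : Z = unshuffle w (fun Y D => unshuffle Y (fun A C => beta A C D)).
  apply: eq_unshuffle => Y D _.
  rewrite (unshuffle_fun _ _ (h := (@sbracket K g (~~ wpar Y))^~ (F D))); last first.
    exact: sbracketBl.
  by apply: eq_unshuffle => A C ACY; rewrite -(word_par_perm _ ACY) word_par_cat.
have Z2 := Z1; rewrite unshuffle_cyclic in Z2.
have Z3 := Z2; rewrite unshuffle_cyclic in Z3.
have : Z + Z + Z = 0.
  rewrite {1}Z1 {1}Z2 Z3 -!unshuffleD -[RHS](unshuffle0 (@par K V) g w).
  apply: eq_unshuffle => Y D YD.
  have /andP[hY hD] : hw Y && hw D by rewrite -all_cat (perm_all _ YD).
  rewrite -!unshuffleD -[RHS](unshuffle0 (@par K V) g Y).
  apply: eq_unshuffle => A C ACY.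
  have /andP[hA hC] : hw A && hw C by rewrite -all_cat (perm_all _ ACY).
  have := @sbracket_jacobi _ _ _ _ _ _ _ _ (Fhomog hA) (Fhomog hC) (Fhomog hD).
  rewrite -!word_par_odd sgn_sgn => <-; congr (_ + _ + sgn _ _).
  by case: (wpar A) (wpar C) (wpar D) => [] [] [].
have -> : Z + Z + Z = 3%:R *: Z by rewrite scaler_nat mulrS mulr2n addrA.
by move/eqP; rewrite scaler_eq0 (negbTE (natf_neq0_char0 2)) => /eqP.
Qed.

(** By symmetry of the bracket, differentiating the second factor contributes as much as
    differentiating the first, which cancels the factor one half. *)
Lemma diff_lie_term w : hw w ->
  diff (2%:R^-1 *: lie_term w)
    = - unshuffle w (fun A B => sbracket (~~ wpar A) (diff (F A)) (F B)).
Proof.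
move=> hw_; rewrite linearZ /= (unshuffle_fun _ _ (h := @diff K g)); last exact: raddfB.
rewrite -[RHS]half_double -!unshuffleN; congr (_ *: _).
rewrite [X in _ = _ + X]unshuffle_cocomm.
transitivity (unshuffle w (fun A B => - sbracket (~~ wpar A) (diff (F A)) (F B))
  + unshuffle w (fun A B => - sgn (wpar A) (sbracket (wpar A) (F A) (diff (F B))))).
  rewrite -unshuffleD; apply: eq_unshuffle => A B AB.
  have /andP[hA hB] : hw A && hw B by rewrite -all_cat (perm_all _ AB).
  by rewrite !word_par_odd (diff_sbracket (Fhomog hA) (Fhomog hB)) negbK.
congr (_ + _); apply: eq_unshuffle => A B AB.
have /andP[hA hB] : hw A && hw B by rewrite -all_cat (perm_all _ AB).
have hdB := diff_degree _ _ (Fhomog hB).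
rewrite sgnN; congr (- _).
have := sbracketC (Fhomog hA) hdB; rewrite -!word_par_odd => ->.
rewrite oddzD -[oddz (sdeg B + 1)]negbK -word_par_odd !sgn_sgn.
by case: (wpar A) (wpar B) => [] [].
Qed.

(* Differentiating the right-hand side of (E_n) with the help of the          *)
(* lower (E_k): the terms F(L(A), L(C), D) cancel in pairs by symmetry, the   *)
(* brackets [F(L(A), C), F(D)] cancel between the two sums, the triple        *)
(* brackets cancel by the Jacobi identity, and only F(L(L(A), C)) remains.    *)
Lemma diff_morphism_defect w : hw w -> size w = n ->
  diff (morphism_defect w) = F [:: (jacobiator w, sdeg w + 3)].
Proof.
move=> hw_ wn; rewrite raddfB /= diff_lie_term // opprK diff_insert //.
(* Expand each defect at its first letter [letter A]: only the Jacobiator term and the brackets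
   containing that letter survive. *)
have -> : unshuffle w (fun A B => morphism_defect (letter A :: B)) =
    F [:: (jacobiator w, sdeg w + 3)]
    - unshuffle w (fun Y D => sbracket (~~ wpar Y)
        (unshuffle Y (fun A C => F (letter A :: C))) (F D)).
  rewrite -insert_jacobiator // unshuffle_coassoc.
  rewrite -[X in X - _]addr0 -(insert_insert_eq0 hw_) -unshuffleD -unshuffleN.
  have -> : unshuffle w (fun Y D => - sbracket (~~ wpar Y)
        (unshuffle Y (fun A C => F (letter A :: C))) (F D)) =
      unshuffle w (fun A B => - unshuffle B (fun C D =>
        sbracket (wpar (letter A :: C)) (F (letter A :: C)) (F D))).
    rewrite !unshuffleN -(unshuffle_coassoc _ w (fun A C D =>
      sbracket (wpar (letter A :: C)) (F (letter A :: C)) (F D))).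
    congr (- _); apply: eq_unshuffle => Y D _.
    rewrite (unshuffle_fun _ _ (h := (@sbracket K g (~~ wpar Y))^~ (F D))); last first.
      exact: sbracketBl.
    apply: eq_unshuffle => A C ACY.
    rewrite -(word_par_perm _ ACY) word_par_cat word_par_cons par_letter.
    by rewrite addNb.
  rewrite -unshuffleD; apply: eq_unshuffle => A B AB.
  have /andP[hA hB] : hw A && hw B by rewrite -all_cat (perm_all _ AB).
  by rewrite morphism_defect_cons ?homog_letterP.
(* A nonempty [B] makes [A] short enough for the lower equations; an empty one contributes nothing
   since [F [::] = 0]. *)
have -> : unshuffle w (fun A B => sbracket (~~ wpar A) (diff (F A)) (F B)) =
    unshuffle w (fun A B => sbracket (~~ wpar A) (morphism_defect A) (F B)).
  apply: eq_unshuffle => A B AB.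
  have /andP[hA hB] : hw A && hw B by rewrite -all_cat (perm_all _ AB).
  case: B AB {hB} => [|x B] AB; first by rewrite Fnil !sbracket0r.
  by rewrite Feq // -wn -(perm_size AB) size_cat /= addnS ltnS leq_addr.
rewrite -addrA -[RHS]addr0; congr (_ + _).
rewrite addrC -unshuffleN -unshuffleD.
transitivity (- (2%:R^-1 *: unshuffle w (fun Y D =>
    sbracket (~~ wpar Y) (lie_term Y) (F D)))); last first.
  by rewrite triple_bracket_eq0 // scaler0 oppr0.
rewrite -unshuffle_scale -unshuffleN; apply: eq_unshuffle => A B _.
by rewrite /morphism_defect sbracketBl sbracketZl addrAC subrr add0r.
Qed.

End Obstruction.

(** * Sums over shuffles *)

Definition word1 (T : Type) n (z : 'I_n -> T) : seq T := [seq z p | p <- enum 'I_n].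

Lemma size_word1 (T : Type) n (z : 'I_n -> T) : size (word1 z) = n.
Proof. by rewrite size_map size_enum_ord. Qed.

Lemma nth_word1 (T : Type) n (z : 'I_n -> T) x (p : 'I_n) : nth x (word1 z) p = z p.
Proof. by rewrite (nth_map p) ?size_enum_ord // nth_ord_enum. Qed.

Lemma word1S (T : Type) n (z : 'I_n.+1 -> T) :
  word1 z = z ord0 :: word1 (fun p => z (lift ord0 p)).
Proof. by rewrite /word1 enum_ordSl /= -map_comp. Qed.

Lemma map_word1 (T U : Type) (h : T -> U) n (z : 'I_n -> T) :
  map h (word1 z) = word1 (fun p => h (z p)).
Proof. by rewrite /word1 -map_comp. Qed.

Lemma big_take_word1 (R : Type) (idx : R) (op : Monoid.com_law idx) (T : Type)
    (G : T -> R) n (z : 'I_n -> T) j :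
  \big[op/idx]_(x <- take j (word1 z)) G x = \big[op/idx]_(p < n | (p < j)%N) G (z p).
Proof.
elim: n z j => [|n IH] z j.
  by rewrite /word1 enum_ord0 /= big_nil big_ord0.
rewrite word1S; case: j => [|j] /=; first by rewrite big_nil big_pred0.
by rewrite big_cons IH [RHS]big_mkcond big_ord_recl /= -big_mkcond.
Qed.

(** A permutation is encoded by the place [j] of the first letter and the arrangement [s] of the
    others, to match the recursion of [unshuffle]. *)
Lemma word_lift_perm (T : Type) n (z : 'I_n.+1 -> T) (j : 'I_n.+1) (s : 'S_n) :
  word z (lift_perm j ord0 s) =
    let w := word (fun p => z (lift ord0 p)) s in
    take j w ++ z ord0 :: drop j w.
Proof.
set w := word _ s => /=.
have sw : size w = n by apply: size_word1.
have sj : size (take j w) = j by rewrite size_takel // sw -ltnS.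
apply: (@eq_from_nth _ (z ord0)); rewrite [size (word _ _)]size_word1.
  by rewrite size_cat /= size_drop sj sw addnS subnKC // -ltnS.
move=> i ltin; rewrite -[i]/(val (Ordinal ltin)) /word nth_word1.
case: (unliftP j (Ordinal ltin)) => [i'|] Ei; rewrite Ei.
  rewrite lift_perm_lift -[z _](@nth_word1 _ _ (fun p => z (lift ord0 (s p))) (z ord0) i').
  rewrite -[word1 _]/w nth_cat sj /= /bump; case: (leqP j i') => ij.
    by rewrite add1n ltnNge leqW //= subSn //= nth_drop subnKC.
  by rewrite add0n ij nth_take.
by rewrite lift_perm_id nth_cat sj ltnn subnn.
Qed.

Section Chi.
Variables (K : fieldType).

(** The first letter is inverted exactly with the letters placed before it. *)
Lemma koszul_sign_lift_perm n (d : 'I_n.+1 -> int) (j : 'I_n.+1) (s : 'S_n) :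
  koszul_sign K d (lift_perm j ord0 s) =
    (\prod_(p < n | (p < j)%N) (-1) ^ (d (lift ord0 (s p)) * d ord0))
    * koszul_sign K (fun p => d (lift ord0 p)) s.
Proof.
rewrite /koszul_sign (bigD1_ord j) //= big_pred0 ?mul1r; last first.
  by move=> q; rewrite lift_perm_id ltn0 andbF.
rewrite [X in _ = X * _]big_mkcond -big_split /=; apply: eq_bigr => p _.
rewrite lift_perm_lift big_mkcond (bigD1_ord j) //= lift_perm_id -big_mkcond /=.
congr (_ * _).
  rewrite /= /bump /= andbT; case: (leqP j p) => jp.
    by rewrite add1n ltnNge leqW.
  by rewrite add0n jp.
apply: eq_big => q; rewrite lift_perm_lift //= /bump !leq0n !add1n ltnS.
by congr (_ && _); case: (leqP j p) (leqP j q) => jp [] jq; lia.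
Qed.

Variables (X : eqType) (deg : X -> int).
Let par (x : X) : bool := ~~ oddz (deg x).
Local Notation wpar := (word_par par).

Lemma wparE (w : seq X) :
  wpar w = \big[addb/false]_(x <- w) oddz (deg x) (+) odd (size w).
Proof.
rewrite /word_par; elim: w => [|x w IH]; first by rewrite !big_nil.
rewrite !big_cons IH /par /=.
by case: (oddz (deg x)) (odd (size w)) (\big[_/_]_(_ <- _) _) => [] [] [].
Qed.

(* (-1)^(twist w) compares skew-symmetric maps with the Koszul symmetric maps *)
(* on the desuspension: the exponent is (n-1)|x_1| + ... + |x_(n-1)|.         *)
Fixpoint twist (w : seq X) : bool :=
  if w is x :: w' then (odd (size w') && oddz (deg x)) (+) twist w' else false.

Lemma twist_cat A B :
  twist (A ++ B) =
    twist A (+) twist B (+)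
    (odd (size B) && (wpar A (+) odd (size A))).
Proof.
rewrite wparE addbK; elim: A => [|x A IH] /=.
  by rewrite big_nil andbF addbF.
rewrite IH size_cat oddD big_cons.
by case: (odd (size A)) (odd (size B)) (oddz (deg x)) (twist A) (twist B)
  (\big[_/_]_(_ <- _) _) => [] [] [] [] [] [].
Qed.

Lemma chi_lift_perm n (z : 'I_n.+1 -> X) (j : 'I_n.+1) (s : 'S_n)
    (z' := fun p => z (lift ord0 p)) (A := take j (word z' s)) :
  chi K (fun p => deg (z p)) (lift_perm j ord0 s) =
    (-1) ^+ (odd (size A) (+) (oddz (deg (z ord0)) && (wpar A (+) odd (size A))))
    * chi K (fun p => deg (z' p)) s.
Proof.
have sA : size A = j by rewrite size_takel // size_word1 -ltnS.
rewrite /chi koszul_sign_lift_perm odd_lift_perm /= addbF sA.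
rewrite !signr_addb mulrACA; congr (_ * _ * _).
rewrite wparE sA addbK big_take_word1.
transitivity ((-1) ^+ (\big[addb/false]_(p < n | (p < j)%N)
    (oddz (deg (z ord0)) && oddz (deg (z' (s p))))) : K).
  have e0 : (-1 : K) ^+ false = 1 by [].
  rewrite (big_morph (fun b : bool => (-1 : K) ^+ b) (@signr_addb K) e0).
  by apply: eq_bigr => p _; rewrite exprN1_oddz oddzM andbC.
by rewrite -big_distrr.
Qed.

End Chi.

Lemma lift_permP n (s : 'S_n.+1) (j : 'I_n.+1) : s j = ord0 ->
  {s' | s = lift_perm j ord0 s'}.
Proof.
move=> sj; pose h k := odflt k (unlift ord0 (s (lift j k))).
have hK k : lift ord0 (h k) = s (lift j k).
  have := neq_lift j k; rewrite /h -(inj_eq (@perm_inj _ s)) sj.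
  by case/unlift_some => k' -> ->.
have h_inj : injective h.
  by move=> k l hkl; apply/(@lift_inj _ j)/(@perm_inj _ s); rewrite -!hK hkl.
exists (perm h_inj); apply/permP => k; case: (unliftP j k) => [k'|] ->.
  by rewrite lift_perm_lift permE hK.
by rewrite lift_perm_id.
Qed.

Lemma sum_lift_perm (W : zmodType) n (P : pred 'S_n.+1) (G : 'S_n.+1 -> W) :
  \sum_(s | P s) G s = \sum_(j < n.+1)
    \sum_(s : 'S_n | P (lift_perm j ord0 s)) G (lift_perm j ord0 s).
Proof.
rewrite (partition_big (fun s : 'S_n.+1 => (s^-1)%g ord0) predT) //=.
apply: eq_bigr => j _.
have hP (s : 'S_n.+1) : ((s^-1)%g ord0 == j) = (s j == ord0).
  by rewrite -(inj_eq (@perm_inj _ s)) permKV eq_sym.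
(* The default value is never reached on permutations with [s j = ord0]. *)
pose unl (s : 'S_n.+1) : 'S_n :=
  if @eqP _ (s j) ord0 is ReflectT e then sval (@lift_permP _ s _ e) else 1%g.
rewrite (reindex (lift_perm j ord0)) /=.
  by apply: eq_bigl => s; rewrite hP lift_perm_id eqxx andbT.
have unlK (s : 'S_n.+1) : s j = ord0 -> lift_perm j ord0 (unl s) = s.
  by rewrite /unl => sj; case: eqP => // e; case: lift_permP.
exists unl => s; rewrite inE hP; last by case/andP => _ /eqP /unlK.
rewrite lift_perm_id eqxx andbT => _; have := unlK _ (lift_perm_id j ord0 s).
move/permP => E; apply/permP => k; apply: (@lift_inj _ ord0).
by have := E (lift j k); rewrite !lift_perm_lift.
Qed.

(** Both blocks of a shuffle increase, so the least value heads one of them: it stands at place [i]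
    or at place 0. *)
Lemma shuffle_lift_perm n (i : nat) (j : 'I_n.+1) (s : 'S_n) :
  shuffle i (lift_perm j ord0 s) =
    if (i == j :> nat) then shuffle i s
    else [&& j == 0 :> nat, (0 < i)%N & shuffle i.-1 s].
Proof.
have H (k : nat) : (forall p q : 'I_n,
     ((lift j p < lift j q < i) || (i <= lift j p < lift j q))%N
     = ((p < q < k) || (k <= p < q))%N) ->
   (forall p, ~~ ((lift j p < j < i) || (i <= lift j p < j))%N) ->
   shuffle i (lift_perm j ord0 s) = shuffle k s.
  move=> Hpq Hj; apply/'forall_forallP/'forall_forallP => Sh p q.
    have := Sh (lift j p) (lift j q); rewrite !lift_perm_lift Hpq.
    by rewrite /= /bump !leq0n !add1n ltnS.
  case: (unliftP j p) => [p'|] ->; case: (unliftP j q) => [q'|] ->.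
  - rewrite !lift_perm_lift Hpq /= /bump !leq0n !add1n ltnS; exact: Sh.
  - by rewrite (negbTE (Hj p')).
  - by rewrite lift_perm_id lift_perm_lift /= /bump leq0n add1n implybT.
  - by rewrite ltnn !andbF.
case: (eqVneq i j) => [ij|ij]; first apply: H => [p q|p].
- rewrite ij /= /bump; case: (leqP j p) (leqP j q) => jp [] jq; lia.
- rewrite ij ltnn andbF /= /bump; case: (leqP j p) => jp; lia.
case: (eqVneq (j : nat) 0%N) => [j0|j0] /=.
  case: (posnP i) => [i0|i_gt0] /=; first by move: ij; rewrite i0 j0.
  by apply: H => [p q|p]; rewrite /= /bump j0 !leq0n; lia.
(* The place just before [j] lies in the same block, yet it would have to carry a value below 0. *)
apply/negP => /'forall_forallP /(_ (inord j.-1) j).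
have jn : (j.-1 < n.+1)%N by apply: leq_ltn_trans (leq_pred _) (ltn_ord j).
rewrite lift_perm_id ltn0 inordK //.
case: (ltnP j i) => [ji|ij'].
  by rewrite /= andbT; have -> : (j.-1 < j)%N by lia.
have -> : (i <= j.-1 < j)%N by lia.
by rewrite orbT.
Qed.

Section SumShuffle.
Variables (K : fieldType) (X : eqType) (deg : X -> int).
Let par (x : X) : bool := ~~ oddz (deg x).
Local Notation wpar := (word_par par).
Local Notation unshuffle := (unshuffle par).
Local Notation twist := (twist deg).

(** Induction on the place of the first letter: the two places allowed in a shuffle give the two
    branches of [unshuffle], and the change of [twist] turns chi into the Koszul sign of the shifted
    degrees. *)
Lemma sum_shuffle (W : lmodType K) n (z : 'I_n -> X) i
    (Phi : seq X -> seq X -> W) : (i <= n)%N ->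
  \sum_(s : 'S_n | shuffle i s) chi K (fun p => deg (z p)) s
      *: Phi (take i (word z s)) (drop i (word z s))
  = sgn (twist (word1 z)) (unshuffle (word1 z) (fun A B =>
      if size A == i then sgn (twist (A ++ B)) (Phi A B) else 0)).
Proof.
elim: n z i Phi => [|n IH] z i Phi.
  rewrite leqn0 => /eqP ->; rewrite (big_pred1 1%g) => [|s]; last first.
    rewrite /= [s]permS0 eqxx; apply/'forall_forallP => p.
    by have := ltn_ord p; rewrite ltn0.
  rewrite /word /word1 enum_ord0 /= /chi /koszul_sign odd_perm1 big_ord0.
  by rewrite mulr1 scale1r.
move=> lein; set z' := fun p => z (lift ord0 p).
have szw : size (word1 z') = n by apply: size_word1.
have left0 : (0 < i)%N ->
    \sum_(s : 'S_n | shuffle i.-1 s)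
      chi K (fun p => deg (z p)) (lift_perm ord0 ord0 s)
      *: Phi (take i (word z (lift_perm ord0 ord0 s)))
             (drop i (word z (lift_perm ord0 ord0 s)))
    = sgn (twist (word1 z)) (unshuffle (word1 z') (fun A B =>
      if size (z ord0 :: A) == i
      then sgn (twist ((z ord0 :: A) ++ B)) (Phi (z ord0 :: A) B) else 0)).
  case: i lein => // i lein _; rewrite /= -/z'.
  transitivity (\sum_(s : 'S_n | shuffle i s) chi K (fun p => deg (z' p)) s *:
    Phi (z ord0 :: take i (word z' s)) (drop i (word z' s))).
    apply: eq_bigr => s _; rewrite chi_lift_perm word_lift_perm /= take0 drop0 /=.
    by rewrite /word_par big_nil andbF expr0 mul1r.
  rewrite (IH z' i (fun A B => Phi (z ord0 :: A) B)) // !sgn_unshuffle.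
  apply: eq_unshuffle => A B AB; rewrite eqSS; case: ifP => _; last by rewrite !sgn0.
  rewrite word1S -/z' /= !sgn_sgn; congr sgn.
  by rewrite (perm_size AB); case: (_ && _) (twist _) (twist _) => [] [] [].
have righti (j : 'I_n.+1) : i = j ->
    \sum_(s : 'S_n | shuffle i s)
      chi K (fun p => deg (z p)) (lift_perm j ord0 s)
      *: Phi (take i (word z (lift_perm j ord0 s)))
             (drop i (word z (lift_perm j ord0 s)))
    = sgn (twist (word1 z)) (unshuffle (word1 z') (fun A B =>
      sgn (par (z ord0) && wpar A) (if size A == i
      then sgn (twist (A ++ z ord0 :: B)) (Phi A (z ord0 :: B)) else 0))).
  move=> ij; have ilen : (i <= n)%N by rewrite ij -ltnS.
  pose e A := odd (size A) (+) (oddz (deg (z ord0)) && (wpar A (+) odd (size A))).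
  transitivity (\sum_(s : 'S_n | shuffle i s) chi K (fun p => deg (z' p)) s *:
    (fun A B => sgn (e A) (Phi A (z ord0 :: B))) (take i (word z' s)) (drop i (word z' s))).
    apply: eq_bigr => s _; rewrite chi_lift_perm word_lift_perm -/z' ij.
    rewrite sgnE scalerA mulrC; congr (_ *: Phi _ _).
      by rewrite take_size_cat // size_takel // size_word1 -ltnS.
    by rewrite drop_size_cat // size_takel // size_word1 -ltnS.
  rewrite (IH z' i (fun A B => sgn (e A) (Phi A (z ord0 :: B)))) //.
  rewrite !sgn_unshuffle; apply: eq_unshuffle => A B AB.
  case: ifP => _; last by rewrite !sgn0.
  rewrite !sgn_sgn; congr sgn; rewrite word1S -/z' /= -(perm_size AB).
  rewrite !twist_cat /= /e size_cat oddD /par.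
  by case: (odd (size A)) (odd (size B)) (oddz _) (twist (word1 z')) (twist A)
    (twist B) (wpar A) => [] [] [] [] [] [] [].
rewrite sum_lift_perm {2}word1S -/z' [unshuffle (_ :: _) _]/= sgnD.
(* With an empty left block only the right branch survives; for [i = n.+1] below, only the left one
   does. *)
case: (posnP i) => [i0|i_gt0].
  rewrite (bigD1 ord0) //= [X in _ + X]big1 ?addr0; last first.
    by move=> j j0; rewrite big_pred0 // => s; rewrite shuffle_lift_perm i0
      eq_sym (negbTE (j0 : (j != 0 :> nat)%N)).
  under eq_bigl do rewrite shuffle_lift_perm {1}i0 eqxx.
  rewrite (righti ord0) // -[LHS]add0r; congr (_ + _).
  rewrite sgn_unshuffle -[LHS](unshuffle0 par W (word1 z')).
  by apply: eq_unshuffle => A B _; rewrite i0 sgn0.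
rewrite (bigD1 ord0) //=; congr (_ + _).
  rewrite -left0 //; apply: eq_bigl => s.
  by rewrite shuffle_lift_perm /= (gtn_eqF i_gt0) i_gt0.
case: (ltngtP i n.+1) lein => // [ltin _|-> _].
  have j0 : Ordinal ltin != ord0 by rewrite -val_eqE /= -lt0n.
  rewrite (bigD1 (Ordinal ltin)) //= [X in _ + X]big1 ?addr0; last first.
    move=> j /andP[j0' ji]; rewrite big_pred0 // => s; rewrite shuffle_lift_perm.
    by rewrite eq_sym -val_eqE in ji; rewrite (negbTE ji) (negbTE (j0' : (j != 0 :> nat)%N)).
  rewrite -(righti (Ordinal ltin)) //; apply: eq_bigl => s.
  by rewrite shuffle_lift_perm eqxx.
rewrite big1 => [|j j0].
  rewrite sgn_unshuffle -[LHS](unshuffle0 par W (word1 z')).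
  apply: eq_unshuffle => A B AB.
  have sA : (size A < n.+1)%N.
    by rewrite ltnS -szw -(perm_size AB) size_cat leq_addr.
  by rewrite (ltn_eqF sA) /= !sgn0.
rewrite big_pred0 // => s; rewrite shuffle_lift_perm gtn_eqF ?ltn_ord //=.
by rewrite (negbTE (j0 : (j != 0 :> nat)%N)).
Qed.

(** The condition tau(1) = 1 retains the left branch for the first letter. *)
Lemma sum_shuffle_first (W : lmodType K) n (z : 'I_n.+1 -> X) i
    (z' := fun p => z (lift ord0 p)) (Phi : seq X -> seq X -> W) :
  (0 < i <= n.+1)%N ->
  \sum_(s : 'S_n.+1 | shuffle i s && fixes_first s)
      chi K (fun p => deg (z p)) s
      *: Phi (take i (word z s)) (drop i (word z s))
  = sgn (twist (word1 z)) (unshuffle (word1 z') (fun A B =>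
      if size (z ord0 :: A) == i
      then sgn (twist (z ord0 :: A ++ B)) (Phi (z ord0 :: A) B) else 0)).
Proof.
case: i => //= i lein; rewrite sum_lift_perm (bigD1 ord0) //= [X in _ + X]big1 ?addr0.
  transitivity (\sum_(s : 'S_n | shuffle i s) chi K (fun p => deg (z' p)) s *:
    Phi (z ord0 :: take i (word z' s)) (drop i (word z' s))).
    apply: eq_big => s.
      rewrite shuffle_lift_perm /= andb_idr // => _.
      apply/forallP => p; apply/implyP => /eqP p0.
      by rewrite (_ : p = ord0) ?lift_perm_id //; apply: val_inj.
    move=> _; rewrite chi_lift_perm word_lift_perm /= take0 drop0 /=.
    by rewrite /word_par big_nil andbF expr0 mul1r.
  rewrite (sum_shuffle z' (fun A B => Phi (z ord0 :: A) B)) // !sgn_unshuffle.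
  apply: eq_unshuffle => A B AB; rewrite eqSS; case: ifP => _; last by rewrite !sgn0.
  rewrite word1S -/z' /= !sgn_sgn; congr sgn.
  by rewrite (perm_size AB); case: (_ && _) (twist _) (twist _) => [] [] [].
move=> j j0; rewrite big_pred0 // => s; apply/negbTE/nandP; right.
apply/negP => /forallP/(_ ord0)/=/eqP E.
have : lift_perm j ord0 s ord0 = lift_perm j ord0 s j.
  by rewrite lift_perm_id; apply: val_inj.
by move/perm_inj => E'; rewrite -E' eqxx in j0.
Qed.

Lemma perm_word n (z : 'I_n -> X) (s : 'S_n) : perm_eq (word z s) (word1 z).
Proof.
rewrite /word /word1 (map_comp z s) perm_map // uniq_perm ?enum_uniq //.
  by rewrite map_inj_uniq ?enum_uniq //; apply: perm_inj.
move=> p; rewrite mem_enum -[p](permKV s) mem_map ?mem_enum //.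
exact: perm_inj.
Qed.

Lemma swap_sym_move (W : zmodType) (hw : pred X) (Psi : seq X -> W) A x B :
  swap_sym par hw Psi -> all hw (A ++ x :: B) ->
  Psi (A ++ x :: B) = sgn (par x && wpar A) (Psi (x :: A ++ B)).
Proof.
move=> sym; elim/last_ind: A B => [|A y IH] B.
  by rewrite /word_par big_nil andbF.
rewrite -!cats1 -!catA /= => h; rewrite sym // IH ?sgn_sgn.
  rewrite -[_ :: B]/([:: y] ++ B) /= word_par_cat word_par_cons /word_par big_nil addbF.
  by congr sgn; case: (par x) (par y) (\big[_/_]_(_ <- _) _) => [] [] [].
by move: h; rewrite !all_cat /= !andbA [X in X && _]andbAC.
Qed.

(** Symmetry under adjacent swaps yields skew-symmetry of the twisted map under all permutations:
    move the first letter to the front and recurse on the others. *)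
Lemma swap_sym_word (W : lmodType K) (hw : pred X) (Psi : seq X -> W) n
    (z : 'I_n -> X) (s : 'S_n) :
  swap_sym par hw Psi -> all hw (word1 z) ->
  sgn (twist (word z s)) (Psi (word z s))
    = chi K (fun p => deg (z p)) s *: sgn (twist (word1 z)) (Psi (word1 z)).
Proof.
elim: n z s Psi => [|n IH] z s Psi sym.
  rewrite permS0 /word /word1 enum_ord0 /= /chi /koszul_sign odd_perm1 big_ord0.
  by rewrite mulr1 scale1r.
have [j sj] : exists j, s j = ord0 by exists ((s^-1)%g ord0); rewrite permKV.
have [s' ->] := @lift_permP _ s _ sj.
move=> hz; have := hz; rewrite -(perm_all _ (perm_word z (lift_perm j ord0 s'))).
move: hz; rewrite word1S => /= /andP[hz0 hz'].
rewrite word_lift_perm chi_lift_perm /=.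
set z' := fun p => z (lift ord0 p); set A := take j _; set B := drop j _ => hAB.
have E : word z' s' = A ++ B by rewrite cat_take_drop.
have := IH z' s' (fun w => Psi (z ord0 :: w)).
rewrite (swap_sym_move sym hAB) E => /(_ _ hz') H.
rewrite -scalerA -sgnE -[sgn (_ (+) twist (word1 _)) _]sgn_sgn -sgnZ -H
  => [|C x y D h]; last first.
  by apply: (sym (z ord0 :: C)); rewrite /= hz0.
rewrite !sgn_sgn; congr sgn.
rewrite -(perm_size (perm_word z' s')) E !twist_cat /= size_cat oddD /par.
by case: (odd (size A)) (odd (size B)) (oddz _) (twist A) (twist B) (wpar A)
  => [] [] [] [] [] [].
Qed.

End SumShuffle.

(** * Desuspension of the operations *)

Lemma koszul_sign_adjacent (K : fieldType) n (d : 'I_n -> int) (i j : 'I_n) :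
  j = i.+1 :> nat -> koszul_sign K d (tperm i j) = (-1) ^ (d i * d j).
Proof.
move=> ij; have ltij : (i < j)%N by rewrite ij.
have inv (p q : 'I_n) : (p < q)%N && (tperm i j q < tperm i j p)%N
    = (p == i) && (q == j).
  rewrite -!val_eqE /=.
  case: (tpermP i j p) => [->|->|/eqP + /eqP +];
    case: (tpermP i j q) => [->|->|/eqP + /eqP +];
    rewrite -?val_eqE /= ij; lia.
rewrite /koszul_sign (bigD1 i) //= (big_pred1 j) => [|q]; last first.
  by rewrite inv eqxx.
rewrite tpermL tpermR mulrC (mulrC (d j)) big1 ?mul1r // => p /negbTE pi.
by rewrite big_pred0 // => q; rewrite inv pi.
Qed.

Lemma chi_adjacent (K : fieldType) n (d : 'I_n -> int) (i j : 'I_n) :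
  j = i.+1 :> nat ->
  chi K d (tperm i j) = (-1) ^+ (~~ (oddz (d i) && oddz (d j))).
Proof.
move=> ij; rewrite /chi (koszul_sign_adjacent K d ij) odd_tperm.
have -> : i != j by rewrite -val_eqE /= ij; lia.
by rewrite exprN1_oddz oddzM -signr_addb.
Qed.

Section Desuspension.
Variables (K : fieldType) (V : gradedLmodType K).
Implicit Types (w A B C D : seq (V * int)).

Local Notation wpar := (word_par (@par K V)).
Local Notation unshuffle := (unshuffle (@par K V)).
Local Notation hw := (all (@homog_letter K V)).
Local Notation twist := (twist (@snd V int)).

Definition op_word (W : Type) (h : operations V W) w : W :=
  app (@h (size w)) (map fst w).

(* Outside of the arities a+1, ..., n-1 the operations are not supposed to    *)
(* be given, and are replaced by 0.                                           *)
Definition desusp (W : lmodType K) (a n : nat) (h : operations V W) w : W :=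
  if (a < size w < n)%N then sgn (twist w) (op_word h w) else 0.

Lemma word1_nth (T : Type) (x0 : T) (w : seq T) :
  word1 (fun p : 'I_(size w) => nth x0 w p) = w.
Proof.
apply: (@eq_from_nth _ x0) => [|i]; rewrite size_word1 // => ltin.
by rewrite -[i]/(val (Ordinal ltin)) nth_word1.
Qed.

Lemma app_word1 (W : Type) n (h : ('I_n -> V) -> W) (xi : 'I_n -> V) :
  app h (word1 xi) = h xi.
Proof. by congr h; apply: funext => p; rewrite nth_word1. Qed.

Lemma op_word1 (W : Type) (h : operations V W) n (z : 'I_n -> V * int) :
  op_word h (word1 z) = @h n (fun p => (z p).1).
Proof. by rewrite /op_word size_word1 map_word1 app_word1. Qed.

Lemma nth_slot (T : Type) (x0 x y : T) (A B : seq T) i :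
  nth x0 (A ++ x :: B) i = if i == size A then x else nth x0 (A ++ y :: B) i.
Proof.
rewrite !nth_cat; case: ltngtP => // [iA|->]; last by rewrite subnn.
by case: (i - size A)%N (subn_gt0 (size A) i) => [|k] //=; rewrite iA.
Qed.

Lemma app_multilinear (W : lmodType K) n (h : ('I_n -> V) -> W) (A B : seq V) a u v :
  multilinear h -> (size A + (size B).+1)%N = n ->
  app h (A ++ (a *: u + v) :: B) = a *: app h (A ++ u :: B) + app h (A ++ v :: B).
Proof.
move=> hlin sAB; have ltAn : (size A < n)%N by rewrite -sAB addnS ltnS leq_addr.
have E x : app h (A ++ x :: B)
    = h [eta (fun p : 'I_n => (A ++ u :: B)`_p) with Ordinal ltAn |-> x].
  by congr h; apply: funext => p /=; rewrite (nth_slot _ x u) -val_eqE.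
by rewrite !E hlin.
Qed.

Section Ops.
Variables (W : gradedLmodType K) (a n : nat) (e : nat -> int) (h : operations V W).
Hypothesis hP : forall k, (a < k < n)%N -> skew_graded_map (e k) (@h k).

Lemma desusp_slot_linear : slot_linear (desusp a n h).
Proof.
move=> A B d b u v; rewrite /desusp !size_cat /=.
case: ifP => [sAB|]; last by rewrite scaler0 addr0.
rewrite !twist_cat /= /op_word !size_cat /= !map_cat /=.
have [hlin _ _] := hP sAB.
by rewrite app_multilinear ?size_map // sgnD sgnZ.
Qed.

Lemma sum_deg w : \sum_(x <- w) x.2 = sdeg w + (size w)%:Z.
Proof.
elim: w => [|x w IH]; first by rewrite /sdeg !big_nil.
rewrite big_cons IH sdeg_cons /=; lia.
Qed.

Lemma desusp_homog w : hw w ->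
  desusp a n h w \in homog (sdeg w + ((size w)%:Z + e (size w))).
Proof.
move=> hw_; rewrite /desusp; case: ifP => [sw|_]; last exact: rpred0.
have [_ hdeg _] := hP sw; apply: rpred_sgn.
rewrite addrA -sum_deg; pose x0 : V * int := (0, 0).
rewrite -{1}(word1_nth x0 w) op_word1.
have -> : \sum_(x <- w) x.2 = \sum_(p < size w) (nth x0 w p).2.
  by rewrite (big_nth x0) big_mkord.
by apply: hdeg => p; apply: (allP hw_); apply: mem_nth.
Qed.

Lemma twist_swap A x y B :
  twist (A ++ x :: y :: B) =
    (oddz x.2 (+) oddz y.2) (+) twist (A ++ y :: x :: B).
Proof.
rewrite !twist_cat /=.
move: (word_par _ A (+) odd (size A)) => c.
by case: (odd _) (oddz x.2) (oddz y.2) (twist A) (twist B) c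
  => [] [] [] [] [] [].
Qed.

(** An adjacent swap contributes 1 + |x||y| to the exponent through chi and |x| + |y| through
    [twist]; modulo 2 the total is (|x| - 1)(|y| - 1). *)
Lemma desusp_swap_sym : swap_sym (@par K V) (@homog_letter K V) (desusp a n h).
Proof.
move=> A x y B hw_; rewrite /desusp.
have sE : size (A ++ y :: x :: B) = size (A ++ x :: y :: B) by rewrite !size_cat.
rewrite sE; case: ifP => sw; last by rewrite sgn0.
have [_ _ hskew] := hP sw.
set w := A ++ x :: y :: B in hw_ sE sw *; pose x0 : V * int := (0, 0).
have i_lt : (size A < size w)%N by rewrite size_cat /= addnS ltnS leq_addr.
have j_lt : ((size A).+1 < size w)%N by rewrite size_cat /= !addnS !ltnS leq_addr.
pose i := Ordinal i_lt; pose j := Ordinal j_lt.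
have nthi : nth x0 w i = x by rewrite nth_cat ltnn subnn.
have nthj : nth x0 w j = y by rewrite nth_cat ltnNge leqnSn subSnn.
have := hskew (fun p => (nth x0 w p).1) (fun p => (nth x0 w p).2) (tperm i j).
rewrite chi_adjacent // nthi nthj.
have -> : (fun p => (nth x0 w (tperm i j p)).1)
    = (fun p : 'I_(size w) => (nth x0 (A ++ y :: x :: B) p).1).
  apply: funext => p; congr fst; case: tpermP => [->|->|/eqP pi /eqP pj].
  - by rewrite nthj nth_cat ltnn subnn.
  - by rewrite nthi nth_cat ltnNge leqnSn subSnn.
  rewrite /w !nth_cat; case: ltngtP => // [Ap|Ap]; last first.
    by rewrite -val_eqE /= Ap eqxx in pi.
  rewrite -val_eqE /= in pj.
  case E: (p - size A)%N => [|[|k]] //=.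
    by move/eqP: E; rewrite subn_eq0 leqNgt Ap.
  by move: pj; rewrite -(subnK (ltnW Ap)) E add1n eqxx.
rewrite -(op_word1 h (fun p => nth x0 w p)) word1_nth.
have -> : h (fun p : 'I_(size w) => (nth x0 (A ++ y :: x :: B) p).1)
    = op_word h (A ++ y :: x :: B).
  rewrite /op_word sE; congr h; apply: funext => p.
  by rewrite (nth_map x0) // sE.
move=> -> => [|p]; last by apply: (allP hw_); apply: mem_nth.
rewrite -sgnE !sgn_sgn twist_swap; congr sgn; rewrite /par.
by case: (oddz x.2) (oddz y.2) (twist _) => [] [] [].
Qed.

End Ops.

Lemma sum_nat_pick (W : zmodType) (m n a : nat) (P : pred nat) (Y : W) :
  \sum_(m <= k < n | P k) (if a == k then Y else 0)
    = if (m <= a < n)%N && P a then Y else 0.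
Proof.
rewrite -big_mkcondr /= -big_filter; case: ifP => H.
  rewrite (_ : [seq _ <- _ | _] = [:: a]) ?big_seq1 //.
  apply: perm_small_eq => //; apply: uniq_perm => //.
    by rewrite filter_uniq // iota_uniq.
  move=> k; rewrite mem_filter mem_index_iota inE; case: (eqVneq a k) => [<-|ak].
    by rewrite andbT andbC H.
  by rewrite andbF.
rewrite (_ : [seq _ <- _ | _] = [::]) ?big_nil //.
apply/eqP; rewrite -[_ == _]negbK -has_filter; apply/hasPn => k; rewrite mem_index_iota => kmn.
by apply/negP => /andP[Pk /eqP ak]; rewrite ak kmn Pk in H.
Qed.

End Desuspension.

(** * The given equations as identities between word functions *)

Section Equations.
Variables (K : fieldType) (V : gradedLmodType K).
Implicit Types (w A B C D : seq (V * int)).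

Local Notation wpar := (word_par (@par K V)).
Local Notation unshuffle := (unshuffle (@par K V)).
Local Notation hw := (all (@homog_letter K V)).
Local Notation twist := (twist (@snd V int)).

Definition letters m (xi : 'I_m -> V) (d : 'I_m -> int) : 'I_m -> V * int :=
  fun p => (xi p, d p).

Lemma map_fst_word m (xi : 'I_m -> V) d s :
  map fst (word (letters xi d) s) = word xi s.
Proof. by rewrite /word -map_comp. Qed.

Lemma oddz_sum_take m (xi : 'I_m -> V) d (s : 'S_m) k :
  oddz (\sum_(p < m | (p < k)%N) d (s p))
    = wpar (take k (word (letters xi d) s))
      (+) odd (size (take k (word (letters xi d) s))).
Proof.
rewrite (wparE (@snd V int)) addbK big_take_word1.
by rewrite (big_morph oddz oddzD (erefl _)).
Qed.

Lemma hw_word1 m (xi : 'I_m -> V) d : homog_word xi d -> hw (word1 (letters xi d)).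
Proof. by move=> h; apply/allP => x /mapP[p _ ->]; apply: h. Qed.

Lemma app_sgn (W : lmodType K) m (h : ('I_m -> V) -> W) b v (B : seq V) :
  multilinear h -> (size B).+1 = m -> app h (sgn b v :: B) = sgn b (app h (v :: B)).
Proof.
move=> hlin sB; apply: (sgn_fun (h := fun v => app h (v :: B))) => x y.
rewrite addrC -scaleN1r (app_multilinear (A := [::]) _ _ _ hlin) //.
by rewrite scaleN1r addrC.
Qed.

Variable n : nat.
Variable l : operations V V.
Local Notation L := (desusp 1 n l).

(** The explicit sign (-1)^(k(j-1)) is the product of the lengths of the two blocks, the amount by
    which the twist of [A ++ B] differs from those of [A] and of [letter L A :: B] together. *)
Lemma sum_insert (W : lmodType K) a (h : operations V W) m (xi : 'I_m -> V) d j k :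
  (m <= n)%N -> (j + k)%N = m.+1 -> (1 < j)%N -> (1 < k)%N -> (a < j)%N ->
  multilinear (@h j) ->
  \sum_(s : 'S_m | shuffle k s) (chi K d s * (-1) ^+ (k * j.-1))
     *: app (@h j) (app (@l k) (take k (word xi s)) :: drop k (word xi s))
  = sgn (twist (word1 (letters xi d))) (unshuffle (word1 (letters xi d)) (fun A B =>
      if size A == k then desusp a n h (letter L A :: B) else 0)).
Proof.
move=> mn jk j1 k1 aj hlin; set z := letters xi d.
transitivity (\sum_(s : 'S_m | shuffle k s) chi K d s *:
  (fun A B => sgn (odd k && odd j.-1)
     (app (@h j) (app (@l k) (map fst A) :: map fst B)))
     (take k (word z s)) (drop k (word z s))).
  apply: eq_bigr => s _; rewrite -scalerA scale_exprN1 oddM.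
  by rewrite map_take map_drop map_fst_word.
have km : (k <= m)%N by lia.
rewrite (sum_shuffle (@snd V int) z (fun A B => sgn (odd k && odd j.-1)
     (app (@h j) (app (@l k) (map fst A) :: map fst B)))) //.
congr sgn; apply: eq_unshuffle => A B AB; case: eqP => // Ak.
have sAB : (size A + size B)%N = m by rewrite -size_cat (perm_size AB) size_word1.
have jB : j = (size B).+1 by lia.
have jn : (a < j < n)%N by lia.
have kn : (1 < k < n)%N by lia.
rewrite {1}/desusp /= /op_word /= -jB jn /letter /= {1}/desusp Ak kn /op_word Ak.
rewrite app_sgn ?size_map // !sgn_sgn; congr sgn.
rewrite twist_cat oddzD addbF oddz_sdeg jB /= Ak.
by case: (odd k) (odd (size B)) (word_par _ A) (twist A) (twist B) => [] [] [] [] [].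
Qed.

Lemma sum_pairs_snd (W : zmodType) m a (Y : W) :
  \sum_(2 <= j < m.+1) \sum_(2 <= k < m.+1 | (j + k == m.+1)%N)
    (if a == k then Y else 0) = if (1 < a < m)%N then Y else 0.
Proof.
transitivity (\sum_(2 <= j < m.+1 | predT j)
    if (m.+1 - a)%N == j then (if (1 < a < m)%N then Y else 0) else 0).
  rewrite big_nat [RHS]big_nat; apply: eq_bigr => j hj; rewrite sum_nat_pick.
  by case: ifP => c1; case: ifP => c2 //; try case: ifP => c3 //; exfalso; lia.
rewrite sum_nat_pick andbT.
by case: ifP => c1; case: ifP => c2 //; exfalso; lia.
Qed.

Lemma sum_pairs_fst (W : zmodType) m a (Y : W) :
  \sum_(2 <= i < m.+1) \sum_(2 <= j < m.+1 | (i + j == m.+1)%N)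
    (if a == i then Y else 0) = if (1 < a < m)%N then Y else 0.
Proof.
transitivity (\sum_(2 <= i < m.+1 | predT i)
    if a == i then (if (1 < a < m)%N then Y else 0) else 0).
  rewrite big_nat [RHS]big_nat; apply: eq_bigr => i hi.
  transitivity (\sum_(2 <= j < m.+1 | predT j)
      if (m.+1 - i)%N == j then (if a == i then Y else 0) else 0).
    rewrite big_mkcond big_nat [RHS]big_nat; apply: eq_bigr => j hj.
    by have -> : (i + j == m.+1)%N = (m.+1 - i == j)%N by lia.
  rewrite sum_nat_pick andbT.
  by case: ifP => c1; case: ifP => c2 //; case: ifP => c3 //; exfalso; lia.
rewrite sum_nat_pick andbT.
by case: ifP => c1; case: ifP => c2 //; exfalso; lia.
Qed.

Hypothesis lP : forall k, (1 < k < n)%N -> skew_graded_map (2 - k%:Z) (@l k).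

Lemma L_small w : (size w <= 1)%N -> L w = 0.
Proof. by rewrite /desusp ltnNge => ->. Qed.

Lemma L_homog w : hw w -> L w \in homog (sdeg w + 2).
Proof. by move=> /(desusp_homog lP); rewrite [X in _ + X]addrC subrK. Qed.

Lemma insert_small (W : lmodType K) (G : seq (V * int) -> W) A B :
  slot_linear G -> (size A <= 1)%N -> G (letter L A :: B) = 0.
Proof. by move=> Glin sA; rewrite /letter L_small // (slot_linear0 [::] _ _ Glin). Qed.

(** The Jacobiator also runs over blocks of length 0, 1 and m, but there the inner or the outer [L]
    sees at most one letter and vanishes. *)
Lemma equationJ_jacobiator m (xi : 'I_m -> V) d (w := word1 (letters xi d)) :
  (m <= n)%N ->
  \sum_(2 <= i < m.+1) \sum_(2 <= j < m.+1 | (i + j == m.+1)%N)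
    \sum_(s : 'S_m | shuffle i s) (chi K d s * (-1) ^+ (i * j.-1))
      *: app (@l j) (app (@l i) (take i (word xi s)) :: drop i (word xi s))
  = sgn (twist w) (jacobiator L w).
Proof.
move=> mn; rewrite /jacobiator sgn_unshuffle.
transitivity (\sum_(2 <= i < m.+1) \sum_(2 <= j < m.+1 | (i + j == m.+1)%N)
    unshuffle w (fun A B => if size A == i
      then sgn (twist w) (L (letter L A :: B)) else 0)).
  rewrite big_nat [RHS]big_nat; apply: eq_bigr => i hi.
  rewrite big_nat_cond [RHS]big_nat_cond; apply: eq_bigr => j /andP[hj /eqP ij].
  rewrite (sum_insert (a := 1)); try lia; last first.
    by have [] : skew_graded_map (2 - j%:Z) (@l j) by apply: lP; lia.
  rewrite sgn_unshuffle; apply: eq_unshuffle => A B _.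
  by case: ifP => //; rewrite sgn0.
under eq_bigr do rewrite unshuffle_sum.
rewrite unshuffle_sum; apply: eq_unshuffle => A B AB; rewrite sum_pairs_fst.
case: ifP => // /negbT; rewrite negb_and -!leqNgt => /orP[sA|sA].
  by rewrite insert_small ?sgn0 //; apply: desusp_slot_linear lP.
have sAB : (size A + size B)%N = m by rewrite -size_cat (perm_size AB) size_word1.
have B0 : (size B <= 0)%N by rewrite -(leq_add2l (size A)) sAB addn0.
by rewrite (L_small (w := letter L A :: B)) ?sgn0.
Qed.

Section Morphism.
Variables (g : dgLieType K) (f : operations V g) (f1 : {linear V -> g}).
Hypothesis f_1 : @f 1 = (fun xi => f1 (xi ord0)).
Hypothesis f1_degree : forall i h, h \in homog i -> f1 h \in homog i.
Hypothesis fP : forall k, (1 < k < n)%N -> skew_graded_map (1 - k%:Z) (@f k).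
Local Notation F := (desusp 0 n f).

Lemma fP1 k : (0 < k < n)%N -> skew_graded_map (1 - k%:Z) (@f k).
Proof.
case: k => [//|[|k]] kn; last by apply: fP.
rewrite f_1; split=> [xi p a u v|xi d h|xi d s h].
- by rewrite (ord1 p) /= linearP.
- by rewrite subrr addr0 big_ord1; apply: f1_degree (h _).
rewrite permS1 perm1 /chi /koszul_sign odd_perm1 big_ord1 big_pred0 => [|p].
  by rewrite mulr1 scale1r.
by rewrite (ord1 p).
Qed.

Lemma F_linear : slot_linear F.
Proof. exact: desusp_slot_linear fP1. Qed.

Lemma F_homog w : hw w -> F w \in homog (sdeg w + 1).
Proof. by move=> /(desusp_homog fP1); rewrite [X in _ + X]addrC subrK. Qed.

Lemma F_letter v d : (1 < n)%N -> F [:: (v, d)] = f1 v.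
Proof. by move=> n1; rewrite /desusp /= n1 /op_word /= f_1. Qed.

(** The splittings with tau(1) = 1 are half of all splittings by [half_lie_term_cons]; e_{s,t}
    combines the desuspension sign of the bracket with the twists of the blocks. *)
Lemma sum_bracket m (xi : 'I_m -> V) d (w := word1 (letters xi d)) :
  [pchar K] =i pred0 -> (m <= n)%N -> homog_word xi d ->
  \sum_(1 <= s < m.+1) \sum_(1 <= t < m.+1 | (s + t == m)%N)
      \sum_(tau : 'S_m | shuffle s tau && fixes_first tau)
        (chi K d tau * e_sign K d s t tau) *:
          bracket (app (@f s) (take s (word xi tau)))
                  (app (@f t) (drop s (word xi tau)))
  = sgn (twist w) (2%:R^-1 *: lie_term F w).
Proof.
case: m xi d @w => [|m] xi d w charK mn hxi.
  rewrite big_geq // /w /word1 enum_ord0 /= /lie_term /= /desusp /=.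
  by rewrite sbracket0l scaler0.
have hw_ := hw_word1 hxi; move: (hw_).
rewrite /w word1S => /= /andP[hx0 hw'].
set z := letters xi d; set w' := word1 (fun p => z (lift ord0 p)).
rewrite (half_lie_term_cons charK F_homog) //.
transitivity (\sum_(1 <= s < m.+2) \sum_(1 <= t < m.+2 | (s + t == m.+1)%N)
    unshuffle w' (fun A B => if (size A).+1 == s then
      sgn (twist (z ord0 :: w'))
       (sbracket (wpar (z ord0 :: A)) (F (z ord0 :: A)) (F B)) else 0)).
  rewrite big_nat [RHS]big_nat; apply: eq_bigr => s hs.
  rewrite big_nat_cond [RHS]big_nat_cond; apply: eq_bigr => t /andP[ht /eqP st].
  pose Phi A B := sgn (odd s.-1 (+) (odd t.-1 && (wpar A (+) odd (size A))))
    (bracket (app (@f s) (map fst A)) (app (@f t) (map fst B))).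
  transitivity (\sum_(tau : 'S_m.+1 | shuffle s tau && fixes_first tau)
     chi K d tau *: Phi (take s (word z tau)) (drop s (word z tau))).
    apply: eq_bigr => tau _; rewrite /e_sign exprN1_oddz oddzM.
    rewrite (oddz_sum_take xi) -[LHS]scalerA; congr (_ *: _).
    rewrite -scalerA !scale_exprN1 oddb sgn_sgn /Phi !map_take !map_drop
      map_fst_word.
    by [].
  rewrite (sum_shuffle_first (@snd V int) z Phi); last by lia.
  rewrite sgn_unshuffle word1S; apply: eq_unshuffle => A B AB /=.
  case: eqP => As; last by rewrite sgn0.
  have sAB : (size A + size B)%N = m.
    by rewrite -size_cat (perm_size AB) size_word1.
  have Bt : size B = t by apply/eqP; rewrite -(eqn_add2l s) st -As addSn sAB.
  have sn : (s < n)%N by lia.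
  have tn : (0 < t < n)%N by lia.
  congr sgn; rewrite /sbracket /desusp /= As Bt sn tn /op_word /= As Bt /Phi.
  rewrite sgn_bracketl sgn_bracketr !sgn_sgn; congr sgn.
  have -> : (odd (size (A ++ B)) && oddz (z ord0).2 (+) twist (A ++ B))
    = twist ((z ord0 :: A) ++ B) by [].
  rewrite twist_cat /= word_par_cons Bt -As.
  have -> : odd t.-1 = ~~ odd t by move: ht; case: (t) => //= k _; rewrite negbK.
  rewrite /= /par.
  by case: (odd (size A)) (odd t) (oddz _) (word_par _ A) (twist A) (twist B)
    => [] [] [] [] [] [].
under eq_bigr do rewrite unshuffle_sum.
rewrite unshuffle_sum sgn_unshuffle; apply: eq_unshuffle => A B AB.
have sAB : (size A + size B)%N = m.
  by rewrite -size_cat (perm_size AB) size_word1.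
case: B AB sAB => [|x B] AB sAB.
  rewrite [F [::]]/desusp /= sbracket0r sgn0 big1_seq // => s /andP[_].
  rewrite mem_index_iota => hs; rewrite big_nat_cond big1 // => t /andP[ht /eqP st].
  by rewrite ifN //; move: sAB => /=; lia.
have Ain : (size A).+1 \in index_iota 1 m.+2.
  by rewrite mem_index_iota; move: sAB => /=; lia.
rewrite (bigD1_seq _ Ain) ?iota_uniq //=.
rewrite [X in _ + X]big1 ?addr0 => [|s sA]; last first.
  by rewrite big1 // => t _; rewrite eq_sym (negbTE sA).
rewrite eqxx -big_filter (_ : [seq _ <- _ | _] = [:: (size B).+1]) ?big_seq1 //.
apply: perm_small_eq => //; apply: uniq_perm; rewrite ?filter_uniq ?iota_uniq //.
by move=> t; rewrite mem_filter mem_index_iota inE; move: sAB => /=; lia.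
Qed.

(** The defect contains one term more than T_m, the insertion of the whole word, which is
    [f1 (L w)]; it is subtracted. *)
Lemma morphism_sum_defect m (xi : 'I_m -> V) d (w := word1 (letters xi d)) :
  [pchar K] =i pred0 -> (1 < m <= n)%N -> homog_word xi d ->
  \sum_(2 <= j < m.+1) \sum_(2 <= k < m.+1 | (j + k == m.+1)%N)
    \sum_(s : 'S_m | shuffle k s) (chi K d s * (-1) ^+ (k * j.-1))
      *: app (@f j) (app (@l k) (take k (word xi s)) :: drop k (word xi s))
  - \sum_(1 <= s < m.+1) \sum_(1 <= t < m.+1 | (s + t == m)%N)
      \sum_(tau : 'S_m | shuffle s tau && fixes_first tau)
        (chi K d tau * e_sign K d s t tau) *:
          bracket (app (@f s) (take s (word xi tau)))
                  (app (@f t) (drop s (word xi tau)))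
  = sgn (twist w) (morphism_defect L F w - f1 (L w)).
Proof.
move=> charK /andP[m1 mn] hxi; rewrite sum_bracket // -/w.
rewrite /morphism_defect addrAC sgnD sgnN; congr (_ - _).
rewrite -(unshuffle_left (@par K V) w (fun A => f1 (L A))) -unshuffleN -unshuffleD.
rewrite sgn_unshuffle.
transitivity (\sum_(2 <= j < m.+1) \sum_(2 <= k < m.+1 | (j + k == m.+1)%N)
    unshuffle w (fun A B => if size A == k
      then sgn (twist w) (F (letter L A :: B)) else 0)).
  rewrite big_nat [RHS]big_nat; apply: eq_bigr => j hj.
  rewrite big_nat_cond [RHS]big_nat_cond; apply: eq_bigr => k /andP[hk /eqP jk].
  rewrite (sum_insert (a := 0)); try lia; last first.
    by have [] : skew_graded_map (1 - j%:Z) (@f j) by apply: fP; lia.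
  rewrite sgn_unshuffle; apply: eq_unshuffle => A B _.
  by case: ifP => //; rewrite sgn0.
under eq_bigr do rewrite unshuffle_sum.
rewrite unshuffle_sum; apply: eq_unshuffle => A B AB; rewrite sum_pairs_snd.
have sAB : (size A + size B)%N = m by rewrite -size_cat (perm_size AB) size_word1.
case: ifP => [sA|/negbT].
  by case: B AB sAB => [|x B] AB sAB /=; [move: sAB => /=; lia | rewrite subr0].
rewrite negb_and -!leqNgt => /orP[sA|sA].
  rewrite insert_small //; last exact: F_linear.
  by rewrite L_small // raddf0; case: ifP; rewrite subrr sgn0.
have -> : B = [::] by case: B AB sAB => //= x B AB; lia.
by rewrite /= F_letter ?subrr ?sgn0 //; lia.
Qed.

End Morphism.

End Equations.

(** * The equations in cohomology *)

Section Transfer.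
Variables (K : fieldType) (charK : [pchar K] =i pred0) (g : dgLieType K).
Local Notation H := (cohomology g).
Variable f1 : {linear H -> g}.
Hypothesis f1_degree : forall i h, h \in homog i -> f1 h \in homog i.
Hypothesis f1_cocycle : forall h, diff (f1 h) = 0.
Hypothesis f1_exact : forall h u, diff u = f1 h -> h = 0.
Implicit Types (w A B : seq (H * int)).

Local Notation unshuffle := (unshuffle (@par K H)).
Local Notation hw := (all (@homog_letter K H)).
Local Notation twist := (twist (@snd H int)).

Variables (n : nat) (l : operations H H) (f : operations H g).
Hypothesis n1 : (1 < n)%N.
Hypothesis lf1 : starts_with l f f1.
Hypothesis lP : forall k, (1 < k < n)%N -> skew_graded_map (2 - k%:Z) (@l k).
Hypothesis fP : forall k, (1 < k < n)%N -> skew_graded_map (1 - k%:Z) (@f k).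
Hypothesis lJ : forall k, (1 < k < n)%N -> equationJ l k.
Hypothesis fE : forall k, (1 < k < n)%N -> equationE l f k.

Local Notation L := (desusp 1 n l).
Local Notation F := (desusp 0 n f).

Let f_1 : @f 1 = (fun xi => f1 (xi ord0)). Proof. by case: lf1. Qed.
Let Flin : slot_linear F. Proof. exact: F_linear f_1 f1_degree fP. Qed.
Let Llin : slot_linear L. Proof. exact: desusp_slot_linear lP. Qed.

Lemma word1_letters w : exists (xi : 'I_(size w) -> H) d,
  word1 (letters xi d) = w /\ (hw w -> homog_word xi d).
Proof.
pose x0 : H * int := (0, 0).
exists (fun p => (nth x0 w p).1), (fun p => (nth x0 w p).2); split.
  by rewrite -[RHS](word1_nth x0); congr word1; apply: funext => p;
    rewrite /letters -surjective_pairing.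
by move=> /allP hw_ p; apply: hw_; apply: mem_nth.
Qed.

Lemma jacobiator_eq0 w : hw w -> (size w < n)%N -> jacobiator L w = 0.
Proof.
move=> hw_ wn; have [w1|w1] := leqP (size w) 1.
  rewrite -(unshuffle0 (@par K H) H w); apply: eq_unshuffle => A B AB.
  rewrite insert_small //; apply: leq_trans w1.
  by rewrite -(perm_size AB) size_cat leq_addr.
have [xi [d [wE /(_ hw_) hxi]]] := word1_letters w.
have := lJ _ hxi; rewrite w1 wn => /(_ isT).
rewrite (equationJ_jacobiator lP) 1?ltnW // wE.
by case: (twist w) => //= /eqP; rewrite oppr_eq0 => /eqP.
Qed.

Lemma defect_small w : (size w <= 1)%N -> morphism_defect L F w = 0.
Proof.
move=> w1; have sA A B : perm_eq (A ++ B) w -> (size A + size B <= 1)%N.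
  by move=> AB; rewrite -size_cat (perm_size AB).
rewrite /morphism_defect /lie_term -[RHS](subr0 0); congr (_ - _).
  rewrite -[RHS](unshuffle0 (@par K H) g w); apply: eq_unshuffle => A B /sA AB.
  by rewrite insert_small // (leq_trans _ AB) // leq_addr.
rewrite -[RHS](scaler0 _ 2%:R^-1); congr (_ *: _).
rewrite -[RHS](unshuffle0 (@par K H) g w); apply: eq_unshuffle => A B /sA.
case: A => [|x A]; first by rewrite [F [::]]/desusp sbracket0l.
case: B => [|y B]; first by rewrite [F [::]]/desusp sbracket0r.
by rewrite /= addnS.
Qed.

(** The term f_1(l_k) of (E_k) is the insertion of the whole word in the defect. On at most one
    letter both sides vanish, [f1] having cocycle values. *)
Lemma diff_F w : hw w -> (size w < n)%N -> diff (F w) = morphism_defect L F w.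
Proof.
move=> hw_ wn; have [w1|w1] := leqP (size w) 1.
  rewrite defect_small //; case: w w1 {hw_ wn} => [|[v d] []] //= _.
    by rewrite raddf0.
  by rewrite (F_letter f_1) // f1_cocycle.
have [xi [d [wE /(_ hw_) hxi]]] := word1_letters w.
have := fE _ hxi; rewrite w1 wn => /(_ isT).
rewrite /termT (morphism_sum_defect l f_1 f1_degree fP) ?w1 1?ltnW // wE.
have LE : L w = sgn (twist w) (l xi).
  by rewrite /desusp w1 wn -(op_word1 l (letters xi d)) wE.
have FE : F w = sgn (twist w) (f xi).
  by rewrite /desusp (ltnW w1) wn -(op_word1 f (letters xi d)) wE.
rewrite f_1 /app /= FE LE !(sgn_fun _ _ (h := f1)); last exact: raddfB.
rewrite (sgn_fun _ _ (h := @diff K g)); last exact: raddfB.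
case: (twist w) => /= [|/addIr //].
by rewrite opprK opprD => /addIr ->; rewrite opprK.
Qed.

Lemma diff_defect w : hw w -> size w = n ->
  diff (morphism_defect L F w) = f1 (jacobiator L w).
Proof.
move=> hw_ wn.
rewrite (diff_morphism_defect charK Llin Flin (L_homog lP)
  (F_homog f_1 f1_degree fP) (n := n)) //.
- by rewrite (F_letter f_1).
- by move=> v; apply: L_small.
- move=> x y B h.
  exact: (desusp_swap_sym (fP1 f_1 f1_degree fP) (A := [::])).
- exact: diff_F.
- exact: jacobiator_eq0.
Qed.

(** The defect is a primitive of [f1] of the Jacobiator, which forces the latter to vanish. *)
Lemma equationJ_top : equationJ l n.
Proof.
move=> xi d hxi; rewrite (equationJ_jacobiator lP) //.
rewrite (f1_exact (diff_defect (hw_word1 hxi) (size_word1 _))).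
exact: sgn0.
Qed.

Lemma defect_cocycle w : equationJ l n -> hw w -> size w = n ->
  diff (morphism_defect L F w) = 0.
Proof.
move=> Jn hw_ wn; rewrite diff_defect //.
have [xi [d [wE /(_ hw_) hxi]]] := word1_letters w.
have := Jn; rewrite -[X in equationJ l X]wn => /(_ _ _ hxi).
rewrite (equationJ_jacobiator lP) ?wn // wE => J0.
have -> : jacobiator L w = 0; last exact: raddf0.
by move: J0; case: (twist w) => //= /eqP; rewrite oppr_eq0 => /eqP.
Qed.

End Transfer.

(** * Multilinear extension from a homogeneous basis *)

Lemma partition_undup (W : zmodType) (I J : eqType) (h : I -> J) (r : seq I)
    (G : I -> W) :
  \sum_(x <- r) G x = \sum_(j <- undup (map h r)) \sum_(x <- r | h x == j) G x.
Proof.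
under [RHS]eq_bigr do rewrite big_mkcond.
rewrite exchange_big /= big_seq [RHS]big_seq; apply: eq_bigr => x xr.
have hx : h x \in undup (map h r) by rewrite mem_undup map_f.
rewrite (bigD1_seq _ hx) ?undup_uniq //= eqxx big1 ?addr0 // => j.
by rewrite eq_sym => /negbTE ->.
Qed.

Section HomogBasis.
Variables (K : fieldType) (V : gradedLmodType K) (B : int -> eqType).
Variable e0 : forall i, B i -> V.
Hypothesis e0_basis : forall i, basis_of_sub (homog i) (@e0 i).
Implicit Types (W : lmodType K).

(** The tag gives each basis letter a definite degree. *)
Definition bidx : eqType := {i : int & B i}.
Definition bidx_of i (k : B i) : bidx := existT _ i k.
Definition bvec (b : bidx) : V := e0 (tagged b).
Definition bletter (b : bidx) : V * int := (bvec b, tag b).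

Lemma bvec_homog b : bvec b \in homog (tag b).
Proof. by have [h _ _] := e0_basis (tag b); apply: h. Qed.

Lemma bvec_free (s : seq bidx) (c : bidx -> K) :
  uniq s -> \sum_(b <- s) c b *: bvec b = 0 -> {in s, forall b, c b = 0}.
Proof.
move=> us s0.
(* Extract from [s] the indices of degree [i], as elements of [B i], so that freeness can be applied
   degree by degree. *)
have sect i : exists s' : seq (B i), [/\ uniq s',
    forall k, (k \in s') = (bidx_of k \in s) &
    forall G : bidx -> V, \sum_(b <- s | tag b == i) G b
      = \sum_(k <- s') G (bidx_of k)].
  elim: {c s0} s us => [|b s IH] /=.
    by move=> _; exists [::]; split=> // G; rewrite !big_nil.
  case/andP=> bs /IH[s' [us' ms' Gs']]; case: b bs => j k bs.
  case: (eqVneq j i) => [ji|ji].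
    subst j; exists (k :: s'); split=> [|k'|G] /=.
    - by rewrite ms' bs.
    - rewrite !inE ms'; congr (_ || _).
      exact/esym/(@eq_Tagged _ _ (bidx_of k') k).
    - by rewrite !big_cons /= eqxx Gs'.
  exists s'; split=> // [k'|G]; last by rewrite big_cons /= (negbTE ji) Gs'.
  rewrite inE ms'; case: eqP => // /(congr1 tag) /= ij.
  by rewrite ij eqxx in ji.
have tag0 : {in undup (map tag s), forall i,
    \sum_(b <- s | tag b == i) c b *: bvec b = 0}.
  apply: homog_free; rewrite ?undup_uniq //.
    move=> i; apply: rpred_sum => b /eqP <-; apply: rpredZ; exact: bvec_homog.
  by rewrite -[RHS]s0 -(partition_undup (fun b : bidx => tag b)).
move=> [i k] iks; have [s' [us' ms' Gs']] := sect i.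
have := tag0 i; rewrite mem_undup Gs' => /(_ (map_f tag iks)) k0.
have [_ free _] := e0_basis i.
by apply: (free s' (fun k => c (bidx_of k))) => //; rewrite ms'.
Qed.

(** Indices may repeat in [r], so that addition is concatenation. *)
Definition lincomb W (y : bidx -> W) (r : seq (K * bidx)) : W :=
  \sum_(x <- r) x.1 *: y x.2.

Lemma lincomb_eq0 W (y : bidx -> W) r : lincomb bvec r = 0 -> lincomb y r = 0.
Proof.
pose c b := \sum_(x <- r | x.2 == b) x.1.
have collect W' (y' : bidx -> W') :
    lincomb y' r = \sum_(b <- undup (map snd r)) c b *: y' b.
  rewrite /lincomb (partition_undup (fun x : K * bidx => x.2)); apply: eq_bigr => b _.
  by rewrite scaler_suml; apply: eq_bigr => x /eqP ->.
rewrite !collect => /(bvec_free (undup_uniq _)) c0.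
by rewrite big_seq big1 // => b br; rewrite c0 // scale0r.
Qed.

Lemma lincomb_cat W (y : bidx -> W) r r' :
  lincomb y (r ++ r') = lincomb y r + lincomb y r'.
Proof. exact: big_cat. Qed.

Lemma lincombZ W (y : bidx -> W) a r :
  lincomb y [seq (a * x.1, x.2) | x <- r] = a *: lincomb y r.
Proof.
by rewrite /lincomb big_map scaler_sumr; apply: eq_bigr => x _; rewrite scalerA.
Qed.

Lemma homog_lincomb i v : v \in homog i -> exists r,
  v = lincomb bvec r /\ all (fun x => tag x.2 == i) r.
Proof.
have [_ _ span] := e0_basis i; case/span => s [c ->].
exists [seq (c k, bidx_of k) | k <- s]; split.
  by rewrite /lincomb big_map.
by apply/allP => x /mapP[k _ ->] /=.
Qed.

Lemma lincomb_span v : exists r, v = lincomb bvec r.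
Proof.
have [s [c [_ hc ->]]] := homog_span v; elim: s => [|i s [r IH]].
  by exists [::]; rewrite /lincomb !big_nil.
have [r' [E _]] := homog_lincomb (hc i).
by exists (r' ++ r); rewrite big_cons IH lincomb_cat -E.
Qed.

Variable coords : V -> seq (K * bidx).
Hypothesis coordsP : forall v, v = lincomb bvec (coords v).

Definition lin_ext W (y : bidx -> W) (v : V) : W := lincomb y (coords v).

Lemma lincomb_eq W (y : bidx -> W) r r' :
  lincomb bvec r = lincomb bvec r' -> lincomb y r = lincomb y r'.
Proof.
move=> E; apply/eqP; rewrite -subr_eq0 -scaleN1r addrC -lincombZ -lincomb_cat.
apply/eqP/lincomb_eq0; rewrite lincomb_cat lincombZ E scaleN1r; exact: addNr.
Qed.

(** The choice [coords] need not be linear; freeness of the basis, through [lincomb_eq], makes the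
    result independent of it. *)
Lemma lin_ext_linear W (y : bidx -> W) : linear (lin_ext y).
Proof.
move=> a u v; rewrite /lin_ext -lincombZ -lincomb_cat; apply: lincomb_eq.
by rewrite lincomb_cat lincombZ -!coordsP.
Qed.

Lemma lin_ext_bvec W (y : bidx -> W) b : lin_ext y (bvec b) = y b.
Proof.
have E W' (y' : bidx -> W') : lincomb y' [:: (1, b)] = y' b.
  by rewrite /lincomb big_seq1 scale1r.
by rewrite -[RHS]E; apply: lincomb_eq; rewrite E -coordsP.
Qed.

Lemma lin_ext_comb W (y y1 y2 : bidx -> W) a v :
  (forall b, y b = a *: y1 b + y2 b) ->
  lin_ext y v = a *: lin_ext y1 v + lin_ext y2 v.
Proof.
move=> yE; rewrite /lin_ext /lincomb scaler_sumr -big_split /=.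
by apply: eq_bigr => x _; rewrite yE scalerDr !scalerA mulrC.
Qed.

Fixpoint mlin_ext W (y : seq bidx -> W) (w : seq V) : W :=
  if w is v :: w' then lin_ext (fun b => mlin_ext (fun t => y (b :: t)) w') v
  else y [::].

Lemma mlin_ext_bvec W (y : seq bidx -> W) t : mlin_ext y (map bvec t) = y t.
Proof. by elim: t y => [|b t IH] y //=; rewrite lin_ext_bvec IH. Qed.

Lemma mlin_ext_linear W (y : seq bidx -> W) A C a u v :
  mlin_ext y (A ++ (a *: u + v) :: C)
    = a *: mlin_ext y (A ++ u :: C) + mlin_ext y (A ++ v :: C).
Proof.
elim: A y => [|x A IH] y /=; first exact: lin_ext_linear.
by apply: lin_ext_comb => b; apply: IH.
Qed.

Lemma slot_word1 (T : Type) n (z : 'I_n -> T) (p : 'I_n) : exists A C,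
  forall x, word1 [eta z with p |-> x] = A ++ x :: C.
Proof.
exists (take p (word1 z)), (drop p.+1 (word1 z)) => x.
have pn : (p < size (word1 z))%N by rewrite size_word1.
apply: (@eq_from_nth _ x) => [|i].
  by rewrite size_cat /= size_take size_drop pn !size_word1 addnS -addSn subnKC.
rewrite size_word1 => ltin; rewrite -[i]/(val (Ordinal ltin)) nth_word1 /=.
rewrite (nth_slot x x (z p)) size_take pn -val_eqE /=; case: eqP => // _.
rewrite -[z p](nth_word1 z x) -drop_nth // cat_take_drop.
by rewrite -[RHS]/(nth x (word1 z) (Ordinal ltin)) nth_word1.
Qed.

Lemma mlin_ext_multilinear W n (y : seq bidx -> W) :
  multilinear (fun xi : 'I_n -> V => mlin_ext y (word1 xi)).
Proof.
move=> xi p a u v; have [A [C E]] := slot_word1 xi p.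
by rewrite !E mlin_ext_linear.
Qed.

(** Reduces multilinear identities on homogeneous words to words of basis vectors of the same
    degrees. *)
Lemma slot_ind n (d : 'I_n -> int) (Q : ('I_n -> V) -> Prop) :
  (forall (xi : 'I_n -> V) (p : 'I_n), Q [eta xi with p |-> 0]) ->
  (forall (xi : 'I_n -> V) (p : 'I_n) (a : K) u v,
     Q [eta xi with p |-> u] -> Q [eta xi with p |-> v] ->
     Q [eta xi with p |-> a *: u + v]) ->
  (forall t : 'I_n -> bidx, (forall p, tag (t p) = d p) -> Q (fun p => bvec (t p))) ->
  forall xi, homog_word xi d -> Q xi.
Proof.
move=> Q0 Qlin Qb.
(* [r] lists the slots not yet known to hold basis vectors. *)
suff claim (r : seq 'I_n) (xi : 'I_n -> V) : homog_word xi d ->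
    (forall p, p \notin r -> exists b, tag b = d p /\ xi p = bvec b) -> Q xi.
  by move=> xi hxi; apply: (claim (enum 'I_n)) => // p; rewrite mem_enum.
elim: r xi => [|p r IH] xi hxi basic.
  have /choice[t tP] : forall p, exists b, tag b = d p /\ xi p = bvec b.
    by move=> p; apply: basic.
  rewrite (_ : xi = fun p => bvec (t p)); first by apply: Qb => p; case: (tP p).
  by apply: funext => p; case: (tP p).
have [s [E /allP sd]] := homog_lincomb (hxi p).
rewrite (_ : xi = [eta xi with p |-> lincomb bvec s]); last first.
  by apply: funext => q /=; case: eqP => // ->.
elim: s sd {E} => [|[a b] s IHs] sd; first by rewrite /lincomb big_nil; apply: Q0.
have bd : tag b = d p by apply/eqP/(sd (a, b)); rewrite mem_head.
rewrite /lincomb big_cons /=; apply: Qlin; last first.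
  by apply: IHs => x xs; apply: sd; rewrite inE xs orbT.
apply: IH => [q|q qr] /=; case: eqP => [->|/eqP qp].
- by rewrite -bd; apply: bvec_homog.
- exact: hxi.
- by exists b.
- by apply: basic; rewrite inE negb_or qp.
Qed.

End HomogBasis.

(** * Symmetrization *)

Lemma unshuffle_homog (K : fieldType) (W : gradedLmodType K) (X : eqType)
    (par : X -> bool) i w (Phi : seq X -> seq X -> W) :
  (forall A B, perm_eq (A ++ B) w -> Phi A B \in homog i) ->
  unshuffle par w Phi \in homog i.
Proof.
elim: w Phi => [|x w IH] Phi hPhi /=; first exact: hPhi.
apply: rpredD; apply: IH => A B AB; first by apply: hPhi; rewrite /= perm_cons.
by apply/rpred_sgn/hPhi; rewrite -cat1s perm_catCA perm_cons.
Qed.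

Lemma perm_swap (X : eqType) (A : seq X) x y B :
  perm_eq (A ++ x :: y :: B) (A ++ y :: x :: B).
Proof. by rewrite perm_cat2l -cat1s -[y :: _]cat1s perm_catCA. Qed.

(** * Degree and symmetry of the defect *)

Section DefectProperties.
Variables (K : fieldType) (V : gradedLmodType K) (g : dgLieType K).
Implicit Types (w A B C D : seq (V * int)).
Local Notation hw := (all (@homog_letter K V)).
Variables (L : seq (V * int) -> V) (F : seq (V * int) -> g).
Hypothesis Flin : slot_linear F.
Hypothesis Lhomog : forall w, hw w -> L w \in homog (sdeg w + 2).
Hypothesis Fhomog : forall w, hw w -> F w \in homog (sdeg w + 1).
Hypothesis Lsym : swap_sym (@par K V) (@homog_letter K V) L.
Hypothesis Fsym : swap_sym (@par K V) (@homog_letter K V) F.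

Lemma morphism_defect_homog w : hw w -> morphism_defect L F w \in homog (sdeg w + 2).
Proof.
move=> hw_; rewrite /morphism_defect.
have hAB A B : perm_eq (A ++ B) w -> hw A /\ hw B.
  by move=> AB; apply/andP; rewrite -all_cat (perm_all _ AB).
apply: rpredB; last apply: rpredZ; apply: unshuffle_homog => A B AB;
  have [hA hB] := hAB _ _ AB.
  have -> : sdeg w + 2 = sdeg (letter L A :: B) + 1.
    by rewrite -(sdeg_perm AB) sdeg_cat sdeg_cons /=; ring.
  by apply: Fhomog; rewrite /= hB andbT; apply: Lhomog.
have -> : sdeg w + 2 = (sdeg A + 1) + (sdeg B + 1).
  by rewrite -(sdeg_perm AB) sdeg_cat; ring.
by apply: rpred_sgn; apply: bracket_degree; apply: Fhomog.
Qed.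

Lemma morphism_defect_sym :
  swap_sym (@par K V) (@homog_letter K V) (morphism_defect L F).
Proof.
move=> A x y B hw_; rewrite /morphism_defect sgnD sgnN sgnZ.
congr (_ - _ *: _); move: A x y B hw_; apply: unshuffle_sym => C hC u x y v h.
- by apply: (Fsym (A := letter L C :: u)); rewrite /= h andbT; apply: Lhomog.
- rewrite /letter Lsym // (sdeg_perm (perm_swap u x y v)).
  apply: (sgn_fun (h := fun z => F ((z, sdeg (u ++ y :: x :: v) + 2) :: C))).
  by move=> z z'; rewrite addrC -scaleN1r (Flin [::] C) scaleN1r addrC.
- by rewrite Fsym // sgn_sbracketr.
- by rewrite Fsym // sgn_sbracketl (word_par_perm _ (perm_swap u x y v)).
Qed.

End DefectProperties.

Section Symmetrization.
Variables (X : eqType) (par : X -> bool).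
Local Notation unshuffle := (unshuffle par).

(* The sum of all signed permutations of the arguments of y: an unshuffle     *)
(* picks the argument that comes first.                                       *)
Fixpoint symmetrize (W : zmodType) k (y : seq X -> W) (t : seq X) : W :=
  if k is k'.+1 then
    unshuffle t (fun A B =>
      if A is [:: x] then symmetrize k' (fun r => y (x :: r)) B else 0)
  else if t is [::] then y [::] else 0.

Lemma symmetrize_sym (W : zmodType) k (y : seq X -> W) :
  swap_sym par xpredT (symmetrize k y).
Proof.
elim: k y => [|k IH] y /=; first by case=> [|a A] x z B _ /=; rewrite sgn0.
apply: unshuffle_sym => [[|a [|b A]] _ C x z D _|B _ [|a [|b A]] x z D _];
  rewrite ?sgn0 //.
by apply: IH; apply/allP.
Qed.

Lemma symmetrize_fun (W W' : zmodType) (h : W -> W') k y t : zmod_morphism h ->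
  h (symmetrize k y t) = symmetrize k (fun r => h (y r)) t.
Proof.
move=> hB; have h0 : h 0 = 0 by rewrite -(subrr 0) hB subrr.
elim: k y t => [|k IH] y t /=; first by case: t.
rewrite (unshuffle_fun _ _ _ hB); apply: eq_unshuffle => A B _.
by case: A => [|a [|b A]].
Qed.

Lemma eq_symmetrize (W : zmodType) k (y y' : seq X -> W) t :
  (forall r, perm_eq r t -> y r = y' r) -> symmetrize k y t = symmetrize k y' t.
Proof.
elim: k y y' t => [|k IH] y y' t yy' /=; first by case: t yy' => // ->.
apply: eq_unshuffle => [[|a [|b A]]] B //= AB; apply: IH => r rB.
by apply: yy'; rewrite -(permPr AB) perm_cons.
Qed.

(** Each letter is brought to the front once, and the symmetry of [Z] undoes the sign of the
    move. *)
Lemma unshuffle_single (W : zmodType) (Z : seq X -> W) t : swap_sym par xpredT Z ->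
  unshuffle t (fun A B => if A is [:: x] then Z (x :: B) else 0) = Z t *+ size t.
Proof.
elim: t Z => [|x t IH] Z Zsym //=.
have -> : unshuffle t (fun A B => if A is [::] then Z (x :: B) else 0) = Z (x :: t).
  rewrite unshuffle_cocomm -[RHS](unshuffle_left par t (fun B => Z (x :: B))).
  by apply: eq_unshuffle => A [|b B] _ /=; rewrite ?sgn0 // /word_par big_nil andbF.
rewrite mulrS; congr (_ + _); rewrite -(IH (fun r => Z (x :: r))); last first.
  by move=> A a b B _; apply: (Zsym (x :: A)); apply/allP.
apply: eq_unshuffle => [[|a [|b A]]] B _ //=; rewrite ?sgn0 //.
rewrite /word_par big_seq1 [RHS](Zsym [::]) //; exact/allP.
Qed.

Lemma symmetrize_id (K : fieldType) (W : lmodType K) k (Z : seq X -> W) t :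
  swap_sym par xpredT Z -> size t = k -> symmetrize k Z t = Z t *+ k`!.
Proof.
elim: k Z t => [|k IH] Z t Zsym /=; first by case: t.
move=> tk; have Zsym' : swap_sym par xpredT (fun r => Z r *+ k`!).
  move=> A x y B h; rewrite Zsym //.
  by apply: (sgn_fun (h := fun z => z *+ k`!)) => u v; rewrite mulrnBl.
rewrite factS mulnC mulrnA -[X in _ *+ X]tk -(unshuffle_single _ Zsym').
apply: eq_unshuffle => [[|a [|b A]]] B //= AB; apply: IH.
  by move=> A' x y C h; apply: (Zsym (a :: A')).
by apply/eqP; rewrite -eqSS -tk -(perm_size AB).
Qed.

Lemma symmetrize_homog (K : fieldType) (W : gradedLmodType K) i k (y : seq X -> W) t :
  (forall r, perm_eq r t -> y r \in homog i) -> symmetrize k y t \in homog i.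
Proof.
elim: k y t => [|k IH] y t hy /=.
  by case: t hy => [|x t] hy; rewrite ?rpred0 ?hy.
apply: unshuffle_homog => [[|a [|b A]]] B AB; rewrite ?rpred0 //.
by apply: IH => r rB; apply: hy; rewrite -(permPr AB) /= perm_cons.
Qed.

End Symmetrization.

(** The component of degree [i - 1] of any primitive is again a primitive; if [u] has no such
    component listed, then [w] is 0. *)
Lemma homog_primitive (K : fieldType) (C : complexType K) i (u w : C) :
  diff u = w -> w \in homog i -> exists2 y, y \in homog (i - 1) & diff y = w.
Proof.
have [s [c [us hc ->]]] := homog_span u; rewrite linear_sum => duw hw.
have us' : uniq (map (+%R^~ 1) s) by rewrite map_inj_uniq //; apply: addIr.
have hdc j : diff (c (j - 1)) \in homog j.
  by have /diff_degree := hc (j - 1); rewrite subrK.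
have [is_|is_] := boolP (i - 1 \in s).
  exists (c (i - 1)); first exact: hc.
  have is' : i \in map (+%R^~ 1) s by apply/mapP; exists (i - 1); rewrite ?subrK.
  have := @homog_free K C (map (+%R^~ 1) s)
    (fun j => diff (c (j - 1)) - (if j == i then w else 0)) us' _ _ i is'.
  rewrite eqxx => H; apply/eqP; rewrite -subr_eq0; apply/eqP/H => [j|].
    by apply: rpredB => //; case: eqP => [->|_] //; apply: rpred0.
  rewrite big_split /= sumrN big_map; apply/eqP; rewrite subr_eq0; apply/eqP.
  rewrite [RHS](bigD1_seq i) //= eqxx [X in _ = _ + X]big1 ?addr0 => [|j /negbTE ->] //.
  by rewrite -duw; apply: eq_bigr => j _; rewrite addrK.
exists 0; rewrite ?rpred0 // raddf0.
have is' : i \notin map (+%R^~ 1) s.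
  by apply: contra is_ => /mapP[j js ->]; rewrite addrK.
have := @homog_free K C (i :: map (+%R^~ 1) s)
    (fun j => if j == i then - w else diff (c (j - 1))) _ _ _ i (mem_head _ _).
rewrite eqxx => H; apply/esym/eqP; rewrite -oppr_eq0; apply/eqP/H => [|j|].
- by rewrite /= is'.
- by case: eqP => [->|_] //; rewrite rpredN.
rewrite big_cons eqxx big_seq [X in _ + X](_ : _ = w) ?addNr //.
rewrite -duw -[LHS]big_seq big_map big_seq [RHS]big_seq; apply: eq_bigr => j js.
rewrite addrK; case: eqP => // ji.
by case/negP: is'; apply/mapP; exists j.
Qed.

(** * Existence of the next operations *)

Lemma set_operation_same (V W : Type) (h : operations V W) n hn :
  @set_operation V W h n hn n = hn.
Proof. exact: dfwith_in. Qed.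

Lemma set_operation_out (V W : Type) (h : operations V W) n hn k :
  k != n -> @set_operation V W h n hn k = h k.
Proof. by move=> kn; rewrite /set_operation dfwith_out // eq_sym. Qed.

Lemma equationJ_ext (K : fieldType) (g : dgLieType K)
    (l l' : operations (cohomology g) (cohomology g)) n :
  (forall k, (k < n)%N -> @l' k = @l k) -> equationJ l n -> equationJ l' n.
Proof.
move=> ll' Jl xi d hxi; rewrite -[RHS](Jl xi d hxi).
rewrite big_nat [RHS]big_nat; apply: eq_bigr => i hi.
rewrite big_nat_cond [RHS]big_nat_cond; apply: eq_bigr => j /andP[hj /eqP ij].
by rewrite !ll' //; lia.
Qed.

Lemma equationE_ext (K : fieldType) (g : dgLieType K)
    (l l' : operations (cohomology g) (cohomology g))
    (f f' : operations (cohomology g) g) n :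
  (0 < n)%N ->
  (forall k, (k <= n)%N -> @l' k = @l k) -> (forall k, (k <= n)%N -> @f' k = @f k) ->
  equationE l f n -> equationE l' f' n.
Proof.
move=> n0 ll' ff' El xi d hxi; rewrite !ll' // !ff' // (El xi d hxi) /termT.
congr (_ - _); rewrite big_nat [RHS]big_nat; apply: eq_bigr => i hi;
  rewrite big_nat_cond [RHS]big_nat_cond; apply: eq_bigr => j /andP[hj /eqP ij].
  by rewrite ff' ?ll' //; lia.
by rewrite !ff' //; lia.
Qed.

Section Existence.
Variables (K : fieldType) (charK : [pchar K] =i pred0) (g : dgLieType K).
Local Notation H := (cohomology g).
Variables (B : int -> eqType) (theta : forall i : int, B i -> cocycle g).
Hypothesis theta_basis : forall i : int,
  basis_of_sub (homog i) (fun k : B i => cohom_class (theta k)).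
Variable f1 : {linear H -> g}.
Hypothesis f1_degree : forall i h, h \in homog i -> f1 h \in homog i.
Hypothesis f1_theta : forall (i : int) (k : B i),
  f1 (cohom_class (theta k)) = \val (theta k).

Local Notation e0 := (fun i (k : B i) => cohom_class (theta k)).
Local Notation bvec := (@bvec K H B e0).
Local Notation bletter := (@bletter K H B e0).
Local Notation bidx := (bidx B).

Lemma f1_class h : exists2 c : cocycle g, \val c = f1 h & cohom_class c = h.
Proof.
have [r ->] := lincomb_span theta_basis h.
exists (\sum_(x <- r) x.1 *: theta (tagged x.2)).
  rewrite !linear_sum; apply: eq_bigr => x _.
  by rewrite !linearZ /= [in RHS]f1_theta.
by rewrite linear_sum; apply: eq_bigr => x _; rewrite linearZ.
Qed.

Lemma f1_cocycle h : diff (f1 h) = 0.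
Proof. by have [c <- _] := f1_class h; apply/eqP/(valP c). Qed.

Lemma f1_exact h u : diff u = f1 h -> h = 0.
Proof.
have [c <- <-] := f1_class h => du.
rewrite -[RHS](linear0 (@cohom_class K g)); apply/cohom_class_eq; exists u.
by rewrite du (linear0 (\val : cocycle g -> g)) subr0.
Qed.

(** With [h] minus the class of [z], the cocycle [z + f1 h] has class zero. This solves (E_n) on one
    word. *)
Lemma cocycle_split i z : z \in homog i -> diff z = 0 ->
  exists h y, [/\ h \in homog i, y \in homog (i - 1) & diff y = z + f1 h].
Proof.
move=> hz dz; have zP : z \in @is_cocycle K g by rewrite inE dz.
pose h : H := - cohom_class (Cocycle zP).
have hh : h \in homog i.
  rewrite rpredN; apply/asboolP; by exists (Cocycle zP).
have [c cE ch] := f1_class h.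
have [u du] : exists u, diff u = \val (Cocycle zP) - \val (- c).
  by apply/cohom_class_eq; rewrite linearN /= ch opprK.
have {}du : diff u = z + f1 h.
  by rewrite du (linearN (\val : cocycle g -> g)) opprK -cE.
have [y hy dy] := homog_primitive du (rpredD hz (f1_degree hh)).
by exists h, y.
Qed.

Variables (n : nat) (l : operations H H) (f : operations H g).
Hypothesis n1 : (1 < n)%N.
Hypothesis lf1 : starts_with l f f1.
Hypothesis lP : forall k, (1 < k < n)%N -> skew_graded_map (2 - k%:Z) (@l k).
Hypothesis fP : forall k, (1 < k < n)%N -> skew_graded_map (1 - k%:Z) (@f k).
Hypothesis lJ : forall k, (1 < k <= n)%N -> equationJ l k.
Hypothesis fE : forall k, (1 < k < n)%N -> equationE l f k.

Local Notation L := (desusp 1 n l).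
Local Notation F := (desusp 0 n f).
Local Notation hw := (all (@homog_letter K H)).
Local Notation parI := (fun b : bidx => ~~ oddz (tag b)).
Local Notation twistI := (twist (fun b : bidx => tag b)).

Let f_1 : @f 1 = (fun xi => f1 (xi ord0)). Proof. by case: lf1. Qed.
Let Flin : slot_linear F. Proof. exact: F_linear f_1 f1_degree fP. Qed.
Let Llin : slot_linear L. Proof. exact: desusp_slot_linear lP. Qed.
Let Lhomog := L_homog lP.
Let Fhomog := F_homog f_1 f1_degree fP.
Let Lsym := desusp_swap_sym lP.
Let Fsym := desusp_swap_sym (fP1 f_1 f1_degree fP).

Let hw_bletter t : hw (map bletter t).
Proof. by apply/allP => x /mapP[b _ ->]; apply: (bvec_homog theta_basis). Qed.

Let T (t : seq bidx) : g := morphism_defect L F (map bletter t).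

Let T_sym : swap_sym parI xpredT T.
Proof.
move=> A x y C _; rewrite /T !map_cat.
by rewrite (morphism_defect_sym Flin Lhomog Lsym Fsym) // -map_cons -map_cons -map_cat.
Qed.

Lemma twist_bletter t : twist (@snd H int) (map bletter t) = twistI t.
Proof. by elim: t => //= b t ->; rewrite size_map. Qed.

Lemma basis_values : exists (h0 : seq bidx -> H) (y0 : seq bidx -> g),
  [/\ swap_sym parI xpredT h0, swap_sym parI xpredT y0,
      forall t, h0 t \in homog (sdeg (map bletter t) + 2),
      forall t, y0 t \in homog (sdeg (map bletter t) + 1)
    & forall t, size t = n -> diff (y0 t) - f1 (h0 t) = T t].
Proof.
have /choice[hy hyP] : forall t : seq bidx, exists hy : H * g,
    [/\ hy.1 \in homog (sdeg (map bletter t) + 2),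
        hy.2 \in homog (sdeg (map bletter t) + 1),
        size t = n -> diff hy.2 = T t + f1 hy.1
      & size t != n -> hy.1 = 0].
  (* Words of other lengths get the value 0, so that [h0] is symmetric on words of every length. *)
  move=> t; have [tn|tn] := eqVneq (size t) n; last first.
    by exists (0, 0); split; rewrite ?rpred0 // => tn'; rewrite tn' eqxx in tn.
  have hT : T t \in homog (sdeg (map bletter t) + 2).
    exact: (morphism_defect_homog Lhomog Fhomog (hw_bletter t)).
  have dT : diff (T t) = 0.
    apply: (@defect_cocycle K charK g f1 f1_degree f1_cocycle n l f) => //.
    - by move=> k /andP[k1 kn]; apply: lJ; rewrite k1 ltnW.
    - by apply: lJ; rewrite n1 leqnn.
    - by rewrite size_map.
  have [h [y [hh hy dy]]] := cocycle_split hT dT.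
  exists (h, y); split=> //=.
  by rewrite (_ : _ + 1 = sdeg (map bletter t) + 2 - 1) //; ring.
pose h0 t := (hy t).1; pose y0 t := (hy t).2.
(* The signed difference of two primitives bounds [f1] of the signed difference of the classes, by
   symmetry of [T]; [f1_exact] concludes. *)
have h0sym : swap_sym parI xpredT h0.
  move=> A x y C _; have sE := perm_size (perm_swap A x y C).
  have [tn|tn] := eqVneq (size (A ++ x :: y :: C)) n; last first.
    have [_ _ _ h1] := hyP (A ++ x :: y :: C).
    have [_ _ _ h2] := hyP (A ++ y :: x :: C).
    by rewrite /h0 h1 // h2 -?sE // sgn0.
  have [_ _ d1 _] := hyP (A ++ x :: y :: C).
  have [_ _ d2 _] := hyP (A ++ y :: x :: C).
  apply/eqP; rewrite -subr_eq0; apply/eqP.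
  apply: (@f1_exact _ (y0 (A ++ x :: y :: C)
    - sgn (parI x && parI y) (y0 (A ++ y :: x :: C)))).
  rewrite !raddfB /= (sgn_fun _ _ (h := @diff K g)); last exact: raddfB.
  rewrite (sgn_fun _ _ (h := f1)); last exact: raddfB.
  rewrite /y0 d1 // d2 -?sE // T_sym ?all_predT //.
  by rewrite [X in _ - X = _]sgnD opprD addrACA subrr add0r.
have Zsym : swap_sym parI xpredT (fun t => T t + f1 (h0 t)).
  move=> A x y C h; rewrite T_sym ?all_predT // h0sym ?all_predT //.
  rewrite [RHS]sgnD; congr (_ + _).
  by apply: sgn_fun; apply: raddfB.
(* Averaging keeps the equation true, since [T t + f1 (h0 t)] is already symmetric and is multiplied
   by n! under symmetrization. *)
have n0 : n`!%:R != 0 :> K.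
  by have := natf_neq0_char0 charK n`!.-1; rewrite prednK // fact_gt0.
exists h0, (fun t => n`!%:R^-1 *: symmetrize parI n y0 t); split=> //.
- by move=> A x y C h; rewrite symmetrize_sym ?all_predT // sgnZ.
- by move=> t; have [] := hyP t.
- move=> t; apply/rpredZ/symmetrize_homog => r rt.
  by rewrite -(sdeg_perm (perm_map bletter rt)); have [] := hyP r.
move=> t tn; rewrite linearZ /= (symmetrize_fun _ _ _ _ (h := @diff K g)); last exact: raddfB.
rewrite (@eq_symmetrize _ _ _ _ _ (fun r => T r + f1 (h0 r))) => [|r rt]; last first.
  by have [_ _ -> //] := hyP r; rewrite (perm_size rt).
rewrite (symmetrize_id Zsym tn) -scaler_nat scalerA mulVf // scale1r.
by rewrite addrK.
Qed.

Lemma exists_next : exists (ln : ('I_n -> H) -> H) (fn : ('I_n -> H) -> g),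
  [/\ skew_graded_map (2 - n%:Z) ln, skew_graded_map (1 - n%:Z) fn
    & equationE (set_operation l ln) (set_operation f fn) n].
Proof.
have [h0 [y0 [h0sym y0sym h0deg y0deg dy0]]] := basis_values.
have /choice[coords coordsP] := lincomb_span theta_basis.
(* The twist undoes the desuspension on basis words, before multilinear extension. *)
pose ext (W : lmodType K) (y : seq bidx -> W) (xi : 'I_n -> H) :=
  mlin_ext coords (fun t => sgn (twistI t) (y t)) (word1 xi).
have extb (W : lmodType K) (y : seq bidx -> W) (t : 'I_n -> bidx) :
    ext W y (fun p => bvec (t p)) = sgn (twistI (word1 t)) (y (word1 t)).
  by rewrite /ext -map_word1 (mlin_ext_bvec theta_basis coordsP).
have extlin (W : lmodType K) (y : seq bidx -> W) : multilinear (ext W y).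
  exact: (mlin_ext_multilinear theta_basis coordsP).
have mult0 (W : lmodType K) (h : ('I_n -> H) -> W) (xi : 'I_n -> H) (p : 'I_n) :
    multilinear h -> h [eta xi with p |-> 0] = 0.
  by move=> hlin; have := hlin xi p (-1) 0 0; rewrite scaler0 addr0 scaleN1r addNr.
have extskew (W : gradedLmodType K) (e : int) (y : seq bidx -> W) :
    swap_sym parI xpredT y ->
    (forall t, y t \in homog (sdeg (map bletter t) + e)) ->
    skew_graded_map (e - n%:Z) (ext W y).
  move=> ysym ydeg; split; first exact: extlin.
    move=> xi d; move: xi; apply: (slot_ind theta_basis (d := d)
    (Q := fun xi => ext W y xi \in homog _)).
    - by move=> xi' p; rewrite mult0 ?rpred0.
    - by move=> xi' p a u v hu hv; rewrite extlin rpredD ?rpredZ.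
    move=> t td; rewrite extb; apply: rpred_sgn.
    rewrite (_ : \sum_(p < n) d p + _ = sdeg (map bletter (word1 t)) + e) //.
    rewrite map_word1 /sdeg /word1 big_map big_enum /=.
    under [X in _ = X + _]eq_bigr => p _ do rewrite td.
    by rewrite big_split /= sumr_const card_ord mulNrn natz; ring.
  move=> xi d s; move: xi; apply: (slot_ind theta_basis (d := d)
    (Q := fun xi => ext W y (fun p => xi (s p)) = chi K d s *: ext W y xi)).
  - move=> xi' p; rewrite mult0 // scaler0.
    rewrite (_ : (fun _ => _) = [eta (fun q => xi' (s q)) with (s^-1)%g p |-> 0]) ?mult0 //.
    by apply: funext => q /=; rewrite -(inj_eq (@perm_inj _ s)) permKV.
  - move=> xi' p a u v.
    have E x : (fun q => [eta xi' with p |-> x] (s q))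
        = [eta (fun q => xi' (s q)) with (s^-1)%g p |-> x].
      by apply: funext => q /=; rewrite -(inj_eq (@perm_inj _ s)) permKV.
    by rewrite !E !extlin => -> ->; rewrite scalerDr !scalerA mulrC.
  move=> t td; rewrite !extb.
  have -> : d = (fun p => tag (t p)) by apply: funext => p; rewrite td.
  exact: (@swap_sym_word K _ (fun b : bidx => tag b) W xpredT y n t s ysym (all_predT _)).
exists (ext H h0), (ext g y0); split; [exact: extskew|exact: extskew|].
set l' := set_operation l _; set f' := set_operation f _.
have l'E k : (k < n)%N -> @l' k = @l k.
  by move=> kn; apply: set_operation_out; rewrite neq_ltn kn.
have f'E k : (k < n)%N -> @f' k = @f k.
  by move=> kn; apply: set_operation_out; rewrite neq_ltn kn.
have L'E : desusp 1 n l' = L.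
  apply: funext => w; rewrite /desusp; case: ifP => // /andP[_ wn].
  by rewrite /op_word l'E.
have F'E : desusp 0 n f' = F.
  apply: funext => w; rewrite /desusp; case: ifP => // /andP[_ wn].
  by rewrite /op_word f'E.
have f'1 : @f' 1 = (fun xi => f1 (xi ord0)) by rewrite f'E.
have f'P k : (1 < k < n)%N -> skew_graded_map (1 - k%:Z) (@f' k).
  by move=> /andP[k1 kn]; rewrite f'E //; apply: fP; rewrite k1.
move=> xi d hxi; rewrite /termT.
rewrite (morphism_sum_defect l' f'1 f1_degree f'P) ?n1 ?leqnn //.
rewrite L'E F'E f'1 /f' /l' !set_operation_same /app /=.
(* The truncation kills [L] at length [n], so the right-hand side of (E_n) is the twisted defect of
   the lower operations. *)
rewrite [desusp 1 n l _]/desusp size_word1 ltnn andbF raddf0 subr0.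
have defect_lin : slot_linear (fun w => sgn (twist (@snd H int) w) (morphism_defect L F w)).
  move=> A C c a u v; rewrite (morphism_defect_slot_linear _ _ _) // sgnD sgnZ.
  by rewrite !twist_cat.
have slotE (xi' : 'I_n -> H) p : exists A C, forall x : H,
    word1 (letters [eta xi' with p |-> x] d) = A ++ (x, d p) :: C.
  have [A [C E]] := slot_word1 (letters xi' d) p; exists A, C => x.
  rewrite -E; congr word1; apply: funext => q /=; rewrite /letters /=.
  by case: eqP => [->|].
(* Both sides are linear in each slot, so basis words suffice. *)
move: xi hxi; apply: (slot_ind theta_basis (d := d)
  (Q := fun xi => diff (ext g y0 xi) - f1 (ext H h0 xi) =
     sgn (twist (@snd H int) (word1 (letters xi d)))
         (morphism_defect L F (word1 (letters xi d))))).
- move=> xi p; rewrite !mult0 // !raddf0 addr0; have [A [C ->]] := slotE xi p.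
  exact/esym/(slot_linear0 _ _ _ defect_lin).
- move=> xi p a u v; have [A [C E]] := slotE xi p; rewrite !E => Eu Ev.
  by rewrite defect_lin -Eu -Ev !extlin !linearP addrACA -scalerDr.
move=> t td; rewrite !extb.
have -> : letters (fun p => bvec (t p)) d = fun p => bletter (t p).
  by apply: funext => p; rewrite /letters -td.
rewrite -(map_word1 bletter t) twist_bletter -/(T _) -dy0 ?size_word1 //.
rewrite (sgn_fun _ _ (h := @diff K g)); last exact: raddfB.
rewrite (sgn_fun _ _ (h := f1)); last exact: raddfB.
by rewrite sgnD sgnN.
Qed.

End Existence.

(** * From the general step to the two statements *)

Lemma equationJ_2 (K : fieldType) (g : dgLieType K)
    (l : operations (cohomology g) (cohomology g)) : equationJ l 2.
Proof. by move=> xi d _; rewrite big_nat1 big_mkcond big_nat1. Qed.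

Lemma starts_with_set_operation (K : fieldType) (g : dgLieType K)
    (l : operations (cohomology g) (cohomology g)) (f : operations (cohomology g) g)
    (f1 : cohomology g -> g) n ln fn :
  (1 < n)%N -> starts_with l f f1 ->
  starts_with (@set_operation _ _ l n ln) (@set_operation _ _ f n fn) f1.
Proof.
by move=> n1 [l1 f_1]; split; rewrite set_operation_out // neq_ltn n1.
Qed.

Theorem proposition3p1 (K : fieldType) (charK : [pchar K] =i pred0)
    (g : dgLieType K)
    (B : int -> eqType) (theta : forall i : int, B i -> cocycle g)
    (theta_degree : forall (i : int) (k : B i), \val (theta i k) \in homog i)
    (theta_basis : forall i : int,
       basis_of_sub (homog i) (fun k : B i => cohom_class (theta i k)))
    (f1 : {linear cohomology g -> g})
    (f1_degree : forall (i : int) (h : cohomology g),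
       h \in homog i -> f1 h \in homog i)
    (f1_theta : forall (i : int) (k : B i),
       f1 (cohom_class (theta i k)) = \val (theta i k)) :
  ((exists (l : operations (cohomology g) (cohomology g))
        (f : operations (cohomology g) g),
      [/\ starts_with l f f1,
          skew_graded_map 0 (l 2%N), skew_graded_map (-1) (f 2%N),
          equationE l f 2 & equationJ l 2])
   /\
   (forall (l : operations (cohomology g) (cohomology g))
        (f : operations (cohomology g) g),
      starts_with l f f1 ->
      skew_graded_map 0 (l 2%N) -> skew_graded_map (-1) (f 2%N) ->
      equationE l f 2 -> equationJ l 2 ->
      equationJ l 3))
  /\
  (forall m : nat, (3 <= m)%N ->
   forall (l : operations (cohomology g) (cohomology g))
        (f : operations (cohomology g) g),
     starts_with l f f1 ->
     (forall k, (2 <= k < m)%N -> skew_graded_map (2 - k%:Z) (l k)) ->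
     (forall k, (2 <= k < m)%N -> skew_graded_map (1 - k%:Z) (f k)) ->
     (forall k, (2 <= k <= m)%N -> equationJ l k) ->
     (forall k, (2 <= k < m)%N -> equationE l f k) ->
     (exists (lm : ('I_m -> cohomology g) -> cohomology g)
        (fm : ('I_m -> cohomology g) -> g),
        [/\ skew_graded_map (2 - m%:Z) lm, skew_graded_map (1 - m%:Z) fm
          & equationE (set_operation l lm) (set_operation f fm) m])
     /\
     (forall (lm : ('I_m -> cohomology g) -> cohomology g)
        (fm : ('I_m -> cohomology g) -> g),
        skew_graded_map (2 - m%:Z) lm -> skew_graded_map (1 - m%:Z) fm ->
        equationE (set_operation l lm) (set_operation f fm) m ->
        equationJ (set_operation l lm) m.+1)).
Proof.
have f1c := f1_cocycle theta_basis f1_theta.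
have f1e := f1_exact theta_basis f1_theta.
split; first split.
(* For n = 2 only the arity 1 operations are given, so the others start as zero. *)
- pose l0 : operations (cohomology g) (cohomology g) := fun _ _ => 0.
  pose f0 : operations (cohomology g) g :=
    @set_operation _ _ (fun _ _ => 0) 1 (fun xi => f1 (xi ord0)).
  have lf0 : starts_with l0 f0 f1 by split=> //; apply: set_operation_same.
  have [] := @exists_next K charK g B theta theta_basis f1 f1_degree f1_theta
    2 l0 f0 isT lf0.
  + by case=> [|[|k]].
  + by case=> [|[|k]].
  + by case=> [|[|[|k]]] // _; apply: equationJ_2.
  + by case=> [|[|k]].
  move=> l2 [f2 [hl2 hf2 E2]].
  exists (set_operation l0 l2), (set_operation f0 f2).
  rewrite !set_operation_same; split=> //; last exact: equationJ_2.
  exact: starts_with_set_operation.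
- move=> l f lf hl2 hf2 E2 J2.
  apply: (equationJ_top charK f1_degree f1c f1e _ lf) => //;
    by case=> [|[|[|k]]].
move=> m m3 l f lf hl hf hJ hE; have m1 : (1 < m)%N by apply: leq_trans m3.
split; first exact: (exists_next charK theta_basis f1_degree f1_theta m1 lf).
move=> lm fm hlm hfm Em.
have out k : (k < m)%N -> k != m by move=> km; rewrite neq_ltn km.
(* The new operations complete the data below arity m + 1. *)
apply: (equationJ_top charK f1_degree f1c f1e (n := m.+1) _
  (starts_with_set_operation lm fm m1 lf)) => [|k|k|k|k]; first exact: leqW.
- case/andP=> k1; rewrite ltnS leq_eqVlt => /orP[/eqP ->|km].
    by rewrite set_operation_same.
  by rewrite set_operation_out ?out //; apply: hl; rewrite k1.
- case/andP=> k1; rewrite ltnS leq_eqVlt => /orP[/eqP ->|km].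
    by rewrite set_operation_same.
  by rewrite set_operation_out ?out //; apply: hf; rewrite k1.
(* (J_k) with k at most m only involves arities below m, where nothing has changed. *)
- case/andP=> k1 km; apply: (equationJ_ext (l := l)); last by apply: hJ; rewrite k1.
  by move=> k' kk'; rewrite set_operation_out ?out // (leq_trans kk').
case/andP=> k1; rewrite ltnS leq_eqVlt => /orP[/eqP -> //|km].
apply: (equationE_ext (l := l) (f := f)).
- exact: ltnW.
- by move=> k' kk'; rewrite set_operation_out ?out // (leq_ltn_trans kk').
- by move=> k' kk'; rewrite set_operation_out ?out // (leq_ltn_trans kk').
by apply: hE; rewrite k1.
Qed.
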